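(* Let $\mathbb T$ be a torus (compact connected abelian Lie group) and let $\mathfrak h$ be a left-invariant hypocomplex structure on $\mathbb T$. If $u\in\mathcal C^\infty(\mathbb T;\Lambda^{p,q})$ satisfies $\mathscr L'_Zu=0$ for all $Z\in\mathfrak h$, then $u$ is left-invariant.
   Context: $G=\mathbb T$; $\mathfrak g$ is the complexification of its Lie algebra of left-invariant vector fields. A left-invariant involutive structure on $G$ is given by a complex subalgebra $\mathfrak h\subset\mathfrak g$ (it spans a subbundle of $\mathbb C TG$, also denoted $\mathfrak h$); $n=\dim_{\mathbb C}\mathfrak h$, $m=\dim G-n$. Set $N^{0,q}(G;\mathfrak h)=\mathcal C^\infty(G;\Lambda^q)$ (smooth complex $q$-forms) and, for $p>0$, $N^{p,q}(G;\mathfrak h)=\{u\in\mathcal C^\infty(G;\Lambda^{p+q}): u(X_1,\dots,X_{p+q})=0$ whenever $q+1$ of the arguments are in $\mathfrak h\}$ ($=0$ if $q<0$). Put $\mathcal C^\infty(G;\Lambda^{p,q})=N^{p,q}(G;\mathfrak h)/N^{p+1,q-1}(G;\mathfrak h)$; the exterior derivative induces $\mathrm d':\mathcal C^\infty(G;\Lambda^{p,q})\to\mathcal C^\infty(G;\Lambda^{p,q+1})$. For $Z\in\mathfrak h$, contraction with $Z$ induces $\imath_Z:\mathcal C^\infty(G;\Lambda^{p,q})\to\mathcal C^\infty(G;\Lambda^{p,q-1})$, and $\mathscr L'_Zu=\imath_Z(\mathrm d'u)+\mathrm d'(\imath_Zu)$. An element of $\mathcal C^\infty(G;\Lambda^{p,q})$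 is left-invariant if it is the class of a left-invariant form in $N^{p,q}(G;\mathfrak h)$. The structure $\mathfrak h$ is locally integrable (near each point there are $m$ smooth functions annihilated by $\mathfrak h$ with linearly independent differentials). It is hypocomplex if for each point $x$ and smooth functions $Z=(Z_1,\dots,Z_m)$ near $x$ annihilated by $\mathfrak h$, with linearly independent differentials and $Z(x)=0$, every germ at $x$ of a smooth function annihilated by $\mathfrak h$ has the form $h\circ Z$ with $h$ a germ of holomorphic function at $0\in\mathbb C^m$. *)

(* Defs.v *)
From HB Require Import structures.
From mathcomp Require Import all_boot all_order all_algebra.
From mathcomp Require Import complex.
From mathcomp Require Import all_classical all_reals all_analysis.
Set Implicit Arguments.
Unset Strict Implicit.
Unset Printing Implicit Defensive.
Import Order.TTheory GRing.Theory Num.Theory numFieldNormedType.Exports.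
Local Open Scope classical_set_scope.
Local Open Scope ring_scope.
Local Open Scope complex_scope.

(* A compact connected abelian Lie group of dimension N, with its real Lie
   algebra identified with R^N.  The exponential map of a connected abelian Lie
   group is a homomorphism and a local homeomorphism; conversely, for such a
   map, the charts v |-> x + exp v (v near 0) have translations of R^N as
   transition maps, so they form a smooth atlas, and it is the one of the Lie
   group. *)
Record torus (R : realType) (N : nat) := Torus {
  torus_group :> topologicalZmodType ;
  torus_exp : {additive 'rV[R]_N -> torus_group} ;
  torus_hausdorff : hausdorff_space torus_group ;
  torus_compact : compact [set: torus_group] ;
  torus_connected : connected [set: torus_group] ;
  torus_exp_continuous : continuous torus_exp ;
  torus_exp_open : forall U : set 'rV[R]_N, open U -> open (torus_exp @` U) ;
  torus_exp_locinj : exists2 U : set 'rV[R]_N, nbhs (0 : 'rV[R]_N) U & set_inj U torus_exp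
}.

(* Germs at 0 of holomorphic functions: Frechet differentiability over K near 0,
   used with K = C. *)
Definition holomorphic_near0 (K : numFieldType) (m : nat)
    (H : 'rV[K]_m -> K) : Prop :=
  \forall z \near (0 : 'rV[K]_m), differentiable H z.

Section Torus.
Context {R : realType} {N : nat} (T : torus R N).
Local Notation C := R[i].

(* g, the complexified Lie algebra.  Its bracket vanishes because T is abelian:
   every complex subspace of g is a subalgebra. *)
Local Notation gC := 'rV[C]_N.

(* f is of class C^n on U, for U open in R^N *)
Fixpoint Ck (n : nat) (U : set 'rV[R]_N) (f : 'rV[R]_N -> R) : Prop :=
  match n with
  | 0 => forall x, U x -> {for x, continuous f}
  | n'.+1 => (forall x, U x -> differentiable f x) /\
             (forall v, Ck n' U ('D_v f))
  end.

Definition in_chart (f : T -> C) (x : T) : 'rV[R]_N -> C :=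
  fun v => f (x + torus_exp T v).

Definition smooth_near (f : T -> C) (x : T) : Prop :=
  exists2 U : set 'rV[R]_N, open_nbhs (0 : 'rV[R]_N) U &
    forall n, Ck n U (@complex.Re R \o in_chart f x) /\
              Ck n U (@complex.Im R \o in_chart f x).

(* Derivative of f at x along the left-invariant vector field of v in R^N *)
Definition vfieldR (v : 'rV[R]_N) (f : T -> C) (x : T) : C :=
  'D_v (@complex.Re R \o in_chart f x) 0
    +i* 'D_v (@complex.Im R \o in_chart f x) 0.

(* The same for Z = X + iY in g *)
Definition vfield (Z : gC) (f : T -> C) (x : T) : C :=
  vfieldR (map_mx (@complex.Re R) Z) f x
    + (0 +i* 1) * vfieldR (map_mx (@complex.Im R) Z) f x.

Definition solution_near (h : {vspace gC}) (f : T -> C) (x : T) : Prop :=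
  smooth_near f x /\ (\forall y \near x, forall Z, Z \in h -> vfield Z f y = 0).

(* Row j of the matrix holds the coordinates, in the dual of the standard basis
   of g, of the differential of F j at y. *)
Definition independent_differentials (m : nat) (F : 'I_m -> T -> C) (y : T) :=
  row_free (\matrix_(j < m, k < N) vfield (delta_mx 0 k) (F j) y).

Definition first_integrals_near (h : {vspace gC}) (m : nat)
    (F : 'I_m -> T -> C) (x : T) : Prop :=
  (forall j, solution_near h (F j) x) /\
  (\forall y \near x, independent_differentials F y).

Definition locally_integrable (h : {vspace gC}) : Prop :=
  forall x : T, exists F : 'I_(N - \dim h) -> T -> C,
    first_integrals_near h F x.

Definition hypocomplex (h : {vspace gC}) : Prop :=
  locally_integrable h /\
  forall (x : T) (F : 'I_(N - \dim h) -> T -> C),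
    first_integrals_near h F x -> (forall j, F j x = 0) ->
    forall f : T -> C, solution_near h f x ->
    exists2 H : 'rV[C]_(N - \dim h) -> C, holomorphic_near0 H &
      \forall y \near x, f y = H (\row_j F j y).

(* A form of degree k on T is determined by its values u x X at the points x
   of T on k left-invariant vector fields, the rows of X. *)
Definition dform (k : nat) := T -> 'M[C]_(k, N) -> C.

Definition multilinear (k : nat) (f : 'M[C]_(k, N) -> C) : Prop :=
  forall (X Y W : 'M[C]_(k, N)) (i : 'I_k) (b c : C),
    row i X = b *: row i Y + c *: row i W ->
    row' i Y = row' i X -> row' i W = row' i X ->
    f X = b * f Y + c * f W.

Definition alternating (k : nat) (f : 'M[C]_(k, N) -> C) : Prop :=
  forall (X : 'M[C]_(k, N)) (i j : 'I_k),
    i != j -> row i X = row j X -> f X = 0.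

(* Membership in C^oo(T; Lambda^k) *)
Definition smooth_form (k : nat) (u : dform k) : Prop :=
  [/\ forall x, multilinear (u x),
      forall x, alternating (u x) &
      forall X x, smooth_near (fun y => u y X) x].

(* Cartan's formula for d on left-invariant vector fields; the terms containing
   brackets vanish. *)
Definition ext_d (k : nat) (u : dform k) : dform k.+1 :=
  fun x X => \sum_(i < k.+1)
    (-1) ^+ i * vfield (row i X) (fun y => u y (row' i X)) x.

Definition interior_prod (Z : gC) (k : nat) (u : dform k.+1) : dform k :=
  fun x X => u x (col_mx Z X).

(* Translations act trivially on left-invariant vector fields, so that
   pulling u back by y |-> a + y only moves the base point. *)
Definition left_invariant_form (k : nat) (u : dform k) : Prop :=
  forall a x X, u (a + x) X = u x X.

(* To be used at degree k = p + q.  The integer q may be negative, since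
   N^{p+1,q-1} occurs for q = 0. *)
Definition in_N (h : {vspace gC}) (p : nat) (q : int) (k : nat) (u : dform k) :
    Prop :=
  match q with
  | Posz q => smooth_form u /\
      ((0 < p)%N -> forall x (X : 'M[C]_(k, N)),
         (q < #|[pred i : 'I_k | row i X \in h]|)%N -> u x X = 0)
  | Negz _ => forall x X, u x X = 0
  end.

Unset Implicit Arguments.

(* The class of u in N^{p,q} / N^{p+1,q-1}, as a coset.  Degrees are written
   q + p so that the degree for q.+1 reduces to the successor of the one
   for q. *)
Definition coset (h : {vspace gC}) (p q : nat) (u : dform (q + p)) :
    set (dform (q + p)) :=
  [set v | in_N h p q%:Z v /\
           in_N h p.+1 (q%:Z - 1) (fun x X => v x X - u x X)].

Definition Lambda (h : {vspace gC}) (p q : nat) : set (set (dform (q + p))) :=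
  [set U | exists2 u, in_N h p q%:Z u & U = coset h p q u].

Definition zero_class (h : {vspace gC}) (p q : nat) : set (dform (q + p)) :=
  coset h p q (fun _ _ => 0).

Definition add_class (k : nat) (U V : set (dform k)) : set (dform k) :=
  [set w | exists u v, [/\ U u, V v & w = (fun x X => u x X + v x X)]].

Definition ext_d' (h : {vspace gC}) (p q : nat) (U : set (dform (q + p))) :
    set (dform (q.+1 + p)) :=
  [set w | exists2 u, U u & coset h p q.+1 (ext_d u) w].

Definition interior' (h : {vspace gC}) (Z : gC) (p q : nat)
    (U : set (dform (q.+1 + p))) : set (dform (q + p)) :=
  [set w | exists2 u, U u & coset h p q (interior_prod Z u) w].

(* For q = 0 the term d'(i_Z U) is absent, Lambda^{p,-1} being 0. *)
Definition Lie' (h : {vspace gC}) (Z : gC) (p q : nat) :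
    set (dform (q + p)) -> set (dform (q + p)) :=
  match q with
  | 0 => fun U => interior' h Z p 0 (ext_d' h p 0 U)
  | q'.+1 => fun U =>
      add_class _ (interior' h Z p q'.+1 (ext_d' h p q'.+1 U))
                  (ext_d' h p q' (interior' h Z p q' U))
  end.

Definition left_invariant_class (h : {vspace gC}) (p q : nat)
    (U : set (dform (q + p))) : Prop :=
  exists u : dform (q + p),
    [/\ in_N h p q%:Z u, left_invariant_form u & U = coset h p q u].

End Torus.

(* Main.v *)
Require Import Defs.
From HB Require Import structures.
From mathcomp Require Import all_boot all_order all_algebra.
From mathcomp Require Import complex.
From mathcomp Require Import all_classical all_reals all_analysis.
From mathcomp Require Import ring lra.

(** Brackets vanish on an abelian group, so Cartan's formula shows that L'_Z of
    the class of u is represented by the form X |-> Z (u X) on invariant fields.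
    Modulo N^{p+1,q-1} only the arguments X with at least q entries in h count:
    the hypothesis says that for those X the function u X is a global solution,
    that is, it is annihilated by h ([Lie'_zero_vfield]).  If global solutions
    are constant, the value of u at the origin is an invariant form in the same
    class ([left_invariant_of_constant_solutions]).  What has to be shown is
    thus that hypocomplexity makes every global solution constant
    ([global_solution_constant]); there are two steps.

    The first step is that no real covector xi <> 0 annihilates h
    ([hypocomplex_no_real_annihilator]).  Such a xi would give, in a logarithmic
    chart at the origin, a real linear solution l, and then every smooth function
    of l is a solution too, for instance chi (l) with chi t = exp (- 1 / t) for
    t > 0 and chi t = 0 otherwise.  Hypocomplexity, applied to linear first
    integrals F, writes chi (l) = H o F with H holomorphic.  On a real line through
    the origin with coordinate l, this says that the restriction of H to a
    complex line is a holomorphic germ of one variable that coincides with chi on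
    the real axis.  But a holomorphic germ that is flat along the positive axis
    is zero ([flat_holomorphic_bound]).  Since holomorphic means differentiable
    over the complex numbers and nothing more, this rests on Goursat's theorem
    ([goursat]).  It is proved by bisection for real differential forms
    p dx + q dy and applied in polar coordinates ([period_integral_eq0]), where it
    yields Cauchy's formula for the difference quotients of f / z^n.

    The second step is a maximum principle in the manner of Bernstein.  Let
    f = a + ib be a global solution and Z = v + iw be in h; then f is holomorphic
    along the planes spanned by v and w.  For lam > 0 the function
    |D_v f|^2 + lam |f|^2 has a maximum on the compact torus, and its Laplacian in
    the plane of v and w is at least 4 lam |D_v f|^2; so D_v f = 0 at the maximum
    ([derive_eq0_at_max]).  Hence |D_v f|^2 <= lam max |f|^2 everywhere, for all
    lam > 0, and D_v f = 0.  The differentials of a and b therefore annihilate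
    Re Z and Im Z for all Z in h, and they vanish by the first step. *)

Set Implicit Arguments.
Unset Strict Implicit.
Unset Printing Implicit Defensive.
Import Order.TTheory GRing.Theory Num.Theory numFieldNormedType.Exports.
Local Open Scope classical_set_scope.
Local Open Scope ring_scope.
Local Open Scope complex_scope.

(** * Differentiability and smoothness in Euclidean space *)

Section DifferentiableEps.
Context {K : numFieldType} {V W : normedModType K}.

Lemma is_diff_eps (f : V -> W) (L : {linear V -> W}) x : continuous L ->
  (forall e, 0 < e ->
     \forall k \near 0, `|f (k + x) - f x - L k| <= e * `|k|) ->
  is_diff x f L.
Proof.
move=> cL fL.
have fE : f \o shift x = cst (f x) + L +o_ 0 id.
  apply/eqaddoP => e e0; near=> k => /=.
  by rewrite !fctE/= opprD addrA; near: k; exact: fL.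
have dfE := diff_unique cL fE.
by apply: DiffDef => //; apply/diff_locallyP; rewrite dfE.
Unshelve. all: by end_near. Qed.

Lemma differentiable_eps (f : V -> W) x : differentiable f x ->
  forall e, 0 < e ->
  \forall k \near 0, `|f (k + x) - f x - 'd f x k| <= e * `|k|.
Proof.
move=> /diff_locallyP[_ /eqaddoP fE] e /fE; apply: filterS => k /=.
by rewrite !fctE/= opprD addrA.
Qed.

Lemma near_eq_differentiable (f g : V -> W) x :
  (\forall y \near x, f y = g y) -> differentiable f x -> differentiable g x.
Proof.
move=> fg df; suff [] : is_diff x g ('d f x) by [].
apply: is_diff_eps => [|e /(differentiable_eps df)].
  exact: diff_continuous.
have := fg; rewrite (near_shift 0 x) subr0; apply: filterS2 => k /= <-.
by rewrite (nbhs_singleton fg).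
Qed.

End DifferentiableEps.

Section Smooth.
Context {R : realType} {N : nat} {T : torus R N}.

Lemma Ck_cst n (U : set 'rV[R]_N) (c : R) : Ck n U (fun=> c).
Proof.
elim: n U c => [|n IH] U c; first by move=> x _; exact: cst_continuous.
split=> [x _|v]; first exact: differentiable_cst.
rewrite (_ : 'D_v _ = fun=> 0) //.
by apply/funext => y; rewrite derive_cst.
Qed.

Lemma smooth_near_cst (c : R[i]) (x : T) : smooth_near (fun=> c) x.
Proof.
exists setT; first by split; [exact: openT|].
by move=> n; split; exact: Ck_cst.
Qed.

Lemma Ck_sub n (U V : set 'rV[R]_N) f : V `<=` U -> Ck n U f -> Ck n V f.
Proof.
move=> VU; elim: n f => [|n IH] f /=; first by move=> H x /VU; exact: H.
by move=> [H1 H2]; split=> [x /VU|v]; [exact: H1|exact: IH].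
Qed.

Lemma Ck_eq n (U : set 'rV[R]_N) f g : open U ->
  (forall x, U x -> f x = g x) -> Ck n U f -> Ck n U g.
Proof.
move=> oU; have near_eq (f' g' : 'rV[R]_N -> R) x : U x ->
    (forall y, U y -> f' y = g' y) -> \forall y \near x, f' y = g' y.
  by move=> Ux fg; apply: filterS fg _; apply: open_nbhs_nbhs; split.
elim: n f g => [|n IH] f g fg /=.
  move=> cf x Ux.
  have fgx := @near_eq_cvg _ _ (nbhs x) (nbhs_filter x) f g (near_eq f g x Ux fg).
  have := cvg_trans fgx (cf x Ux).
  by rewrite (fg x Ux).
move=> [df Df]; split=> [x Ux|v].
  exact: near_eq_differentiable (near_eq f g x Ux fg) (df x Ux).
apply: IH (Df v) => x Ux; apply: near_eq_derive.
exact: near_eq.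
Qed.

Lemma CkB n (U : set 'rV[R]_N) f g : open U ->
  Ck n U f -> Ck n U g -> Ck n U (fun x => f x - g x).
Proof.
move=> oU; elim: n f g => [|n IH] f g.
  by move=> cf cg x Ux; exact: (continuousB (cf x Ux) (cg x Ux)).
move=> [df Df] [dg Dg]; split=> [x Ux|v].
  by apply: differentiableB; [exact: df|exact: dg].
apply: Ck_eq oU _ (IH _ _ (Df v) (Dg v)) => x Ux.
rewrite -deriveB//; apply: diff_derivable; [exact: df|exact: dg].
Qed.

Lemma smooth_nearB (f g : T -> R[i]) x :
  smooth_near f x -> smooth_near g x -> smooth_near (fun y => f y - g y) x.
Proof.
move=> [U [oU U0] fU] [V [oV V0] gV]; exists (U `&` V).
  by split; [exact: openI|].
have oUV := openI oU oV.
move=> n; have [fr fi] := fU n; have [gr gi] := gV n.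
have UV := @subIsetl _ U V; have VU := @subIsetr _ U V.
split.
- apply: Ck_eq oUV _ (CkB oUV (Ck_sub UV fr) (Ck_sub VU gr)) => y _.
  by rewrite /= /in_chart; case: (f _) => a b; case: (g _).
- apply: Ck_eq oUV _ (CkB oUV (Ck_sub UV fi) (Ck_sub VU gi)) => y _.
  by rewrite /= /in_chart; case: (f _) => a b; case: (g _).
Qed.

Lemma vfieldR_cst v (c : R[i]) (x : T) : vfieldR v (fun=> c) x = 0.
Proof. by rewrite /vfieldR !derive_cst. Qed.

Lemma vfield_cst Z (c : R[i]) (x : T) : vfield Z (fun=> c) x = 0.
Proof. by rewrite /vfield !vfieldR_cst mulr0 addr0. Qed.

End Smooth.

(** * Goursat's theorem on rectangles *)

Section Goursat.
Context {R : realType}.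
Implicit Types (a b c d x y e : R).

Lemma increment_bound (f df : R -> R) a b M : a <= b ->
  (forall x, a <= x <= b -> is_derive x 1 f (df x)) ->
  (forall x, a <= x <= b -> `|df x| <= M) -> `|f b - f a| <= M * (b - a).
Proof.
move=> ab fdf dfM.
have [x xab ->] : exists2 x, x \in `[a, b] & f b - f a = df x * (b - a).
  apply: MVT_segment => //.
    by move=> x; rewrite in_itv /= => /andP[ax xb]; apply: fdf; rewrite (ltW ax) (ltW xb).
  apply: derivable_within_continuous => x; rewrite in_itv/= => xab.
  by have [] := fdf x xab.
rewrite normrM (ger0_norm (_ : 0 <= b - a)) ?subr_ge0//.
by rewrite ler_wpM2r ?subr_ge0//; apply: dfM; move: xab; rewrite in_itv.
Qed.

Lemma linear_pairE (L : {linear (R * R)%type -> R}) (u v : R) :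
  L (u, v) = u * L (1, 0) + v * L (0, 1).
Proof.
have -> : (u, v) = u *: ((1, 0) : R * R) + v *: ((0, 1) : R * R).
  by congr (_, _); rewrite /= /GRing.scale /=; ring.
by rewrite linearD !linearZ.
Qed.

Section Bisection.
Variables (A : R -> R -> R -> R -> R) (a b c d : R).
Hypothesis addl : forall x0 x1 x2 y0 y1,
  A x0 x2 y0 y1 = A x0 x1 y0 y1 + A x1 x2 y0 y1.
Hypothesis addr : forall x0 x1 y0 y1 y2,
  A x0 x1 y0 y2 = A x0 x1 y0 y1 + A x0 x1 y1 y2.

Let w n : R := (b - a) / 2 ^+ n.
Let v n : R := (d - c) / 2 ^+ n.
Let large n (z : R * R) : Prop :=
  [/\ a <= z.1, z.1 + w n <= b, c <= z.2, z.2 + v n <= d &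
      `|A a b c d| <= 4 ^+ n * `|A z.1 (z.1 + w n) z.2 (z.2 + v n)|].
Let inside n (z z' : R * R) : Prop :=
  [/\ z.1 <= z'.1, z'.1 + w n.+1 <= z.1 + w n, z.2 <= z'.2 &
      z'.2 + v n.+1 <= z.2 + v n].

Let wS n : w n = w n.+1 + w n.+1.
Proof. by rewrite /w exprS; field; rewrite expf_neq0. Qed.

Let vS n : v n = v n.+1 + v n.+1.
Proof. by rewrite /v exprS; field; rewrite expf_neq0. Qed.

Hypotheses (ab : a <= b) (cd : c <= d).

Let w_ge0 n : 0 <= w n.
Proof. by rewrite divr_ge0 ?exprn_ge0// subr_ge0. Qed.

Let v_ge0 n : 0 <= v n.
Proof. by rewrite divr_ge0 ?exprn_ge0// subr_ge0. Qed.

Let large_quarter n z : exists z', large n z -> large n.+1 z' /\ inside n z z'.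
Proof.
have [[ax xb cy yd big]|nlarge] := pselect (large n z); last first.
  by exists z => /nlarge.
case: z ax xb cy yd big => x y /= ax xb cy yd big.
pose Q s t := `|A (x + s) (x + s + w n.+1) (y + t) (y + t + v n.+1)|.
have w0 := w_ge0 n.+1; have v0 := v_ge0 n.+1.
have sum4 : `|A x (x + w n) y (y + v n)| <=
    Q 0 0 + Q 0 (v n.+1) + Q (w n.+1) 0 + Q (w n.+1) (v n.+1).
  rewrite /Q !addr0 (wS n) (vS n) !addrA.
  rewrite (addl x (x + w n.+1)) (addr x _ y (y + v n.+1)).
  rewrite (addr (x + _) _ y (y + v n.+1)) !addrA.
  by do 3! [rewrite (le_trans (ler_normD _ _))// lerD2r].
have quarter s t : (s == 0) || (s == w n.+1) -> (t == 0) || (t == v n.+1) ->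
    `|A a b c d| <= 4 ^+ n.+1 * Q s t ->
    exists z', large n (x, y) -> large n.+1 z' /\ inside n (x, y) z'.
  move=> s01 t01 QE; exists (x + s, y + t) => _.
  rewrite (wS n) in xb; rewrite (vS n) in yd.
  rewrite /inside /= (wS n) (vS n).
  have s0w : 0 <= s <= w n.+1 by case/orP: s01 => /eqP ->; rewrite lexx w0.
  have t0v : 0 <= t <= v n.+1 by case/orP: t01 => /eqP ->; rewrite lexx v0.
  by split; split => //=; lra.
have [q1|q1] := leP `|A a b c d| (4 ^+ n.+1 * Q 0 0).
  by apply: (quarter _ _ _ _ q1); rewrite eqxx ?orbT.
have [q2|q2] := leP `|A a b c d| (4 ^+ n.+1 * Q 0 (v n.+1)).
  by apply: (quarter _ _ _ _ q2); rewrite eqxx ?orbT.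
have [q3|q3] := leP `|A a b c d| (4 ^+ n.+1 * Q (w n.+1) 0).
  by apply: (quarter _ _ _ _ q3); rewrite eqxx ?orbT.
have [q4|q4] := leP `|A a b c d| (4 ^+ n.+1 * Q (w n.+1) (v n.+1)).
  by apply: (quarter _ _ _ _ q4); rewrite eqxx ?orbT.
exfalso; rewrite exprS in q1 q2 q3 q4.
have := ler_wpM2l (exprn_ge0 n (ler0n R 4)) sum4; lra.
Qed.

(** Goursat's bisection.  One of the four quarters of a rectangle carries at
    least a quarter of the absolute value of A.  The nested rectangles obtained
    in this way shrink to a point, near which A is smaller than any multiple of
    the square of the size, whereas it decays at most like 4^-n. *)
Lemma additive_rectangle_eq0 :
  (forall x y, a <= x <= b -> c <= y <= d -> forall e, 0 < e ->
   exists2 r, 0 < r & forall x0 x1 y0 y1,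
     a <= x0 <= x -> x <= x1 <= b -> c <= y0 <= y -> y <= y1 <= d ->
     x1 - x0 < r -> y1 - y0 < r ->
     `|A x0 x1 y0 y1| <= e * (x1 - x0 + (y1 - y0)) ^+ 2) ->
  A a b c d = 0.
Proof.
move=> loc; apply/eqP; apply: contrapT => /negP A0.
have [F FP] := choice (fun m : nat * (R * R) => large_quarter m.1 m.2).
pose z := fix z n := if n is k.+1 then F (k, z k) else (a, c).
have zlarge n : large n (z n).
  elim: n => [|n IH]; last by have [] := FP (n, z n) IH.
  by split => //=; rewrite /w /v ?expr0 ?divr1 ?subrKC ?mul1r.
have zin n : inside n (z n) (z n.+1) by have [] := FP (n, z n) (zlarge n).
have zinD n k : [/\ (z n).1 <= (z (n + k)%N).1,
    (z (n + k)%N).1 + w (n + k) <= (z n).1 + w n,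
    (z n).2 <= (z (n + k)%N).2 &
    (z (n + k)%N).2 + v (n + k) <= (z n).2 + v n].
  elim: k => [|k [i1 i2 i3 i4]]; first by rewrite addn0.
  have [j1 j2 j3 j4] := zin (n + k)%N; rewrite addnS.
  by split; [exact: le_trans i1 j1|exact: le_trans j2 i2
    |exact: le_trans i3 j3|exact: le_trans j4 i4].
have zle m n : (z m).1 <= (z n).1 + w n /\ (z m).2 <= (z n).2 + v n.
  have [mn|nm] := leqP m n.
    have [i1 _ i2 _] := zinD m (n - m)%N; rewrite subnKC// in i1 i2.
    by split; rewrite ler_wpDr.
  have [_ i1 _ i2] := zinD n (m - n)%N; rewrite (subnKC (ltnW nm)) in i1 i2.
  by split; [apply: le_trans i1|apply: le_trans i2]; rewrite lerDl.
pose X := range (fun n => (z n).1); pose Y := range (fun n => (z n).2).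
have X0 : X !=set0 by exists (z 0%N).1, 0%N.
have Y0 : Y !=set0 by exists (z 0%N).2, 0%N.
have Xub n : ubound X ((z n).1 + w n) by move=> _ [m _ <-]; have [] := zle m n.
have Yub n : ubound Y ((z n).2 + v n) by move=> _ [m _ <-]; have [] := zle m n.
have xs n : (z n).1 <= sup X <= (z n).1 + w n.
  apply/andP; split; last exact: ge_sup.
  by apply: ub_le_sup; [exists ((z 0%N).1 + w 0%N)|exists n].
have ys n : (z n).2 <= sup Y <= (z n).2 + v n.
  apply/andP; split; last exact: ge_sup.
  by apply: ub_le_sup; [exists ((z 0%N).2 + v 0%N)|exists n].
have w00 : w 0%N = b - a by rewrite /w expr0 divr1.
have v00 : v 0%N = d - c by rewrite /v expr0 divr1.
have := xs 0%N; have := ys 0%N; rewrite /= w00 v00 !subrKC => ys0 xs0.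
pose S := b - a + (d - c).
have S0 : 0 <= S by rewrite addr_ge0// subr_ge0.
have S1 : 0 < S ^+ 2 + 1 by rewrite ltr_wpDl// sqr_ge0.
(* this choice gives e * S ^+ 2 < `|A a b c d| *)
have e0 : 0 < `|A a b c d| / (S ^+ 2 + 1) by rewrite divr_gt0// normr_gt0.
have [r r0 Ar] := loc _ _ xs0 ys0 _ e0.
have [n Sn] : exists n, S / 2 ^+ n < r.
  pose n := Num.trunc (S / r).
  have := truncnS_gt (S / r) => Sr.
  exists n.+1; rewrite ltr_pdivrMr ?exprn_gt0// -ltr_pdivrMl// mulrC.
  rewrite (lt_le_trans Sr)// -natrX ler_nat.
  exact/ltnW/ltn_expl.
have [l1 l2 l3 l4 l5] := zlarge n.
have wvn : w n + v n = S / 2 ^+ n by rewrite /w /v -mulrDl.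
have := Ar (z n).1 ((z n).1 + w n) (z n).2 ((z n).2 + v n).
have /andP[x1 x2] := xs n; have /andP[y1 y2] := ys n.
rewrite l1 l2 l3 l4 x1 x2 y1 y2 !(addrC _ (w n)) !(addrC _ (v n)) !addrK.
move=> /(_ isT isT isT isT).
have w0 := w_ge0 n; have v0 := v_ge0 n.
have wr : w n < r by lra.
have vr : v n < r by lra.
move=> /(_ wr vr); rewrite wvn leNgt => /negP; apply.
rewrite !(addrC _ (w n)) !(addrC _ (v n)) in l5.
have h4 : 0 < 4 ^+ n :> R by rewrite exprn_gt0.
rewrite -(ltr_pM2l h4); apply: lt_le_trans l5.
have -> : 4 ^+ n * (`|A a b c d| / (S ^+ 2 + 1) * (S / 2 ^+ n) ^+ 2) =
    `|A a b c d| / (S ^+ 2 + 1) * S ^+ 2.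
  have -> : 4 ^+ n = (2 ^+ n) ^+ 2 :> R.
    by rewrite -exprM mulnC exprM; congr (_ ^+ n); ring.
  by field; rewrite ?expf_neq0//= gt_eqF.
rewrite mulrAC ltr_pdivrMr// ltr_pM2l ?normr_gt0//.
by rewrite ltrDl.
Qed.

End Bisection.

(** The derivatives of p and q need not be continuous, which is what holomorphic
    functions call for.  Primitives P and Q stand for the integrals along the
    sides: additivity of the circulation is then plain algebra, and its local
    smallness is the mean value inequality applied to differences of P and Q. *)
Lemma goursat (p q P Q : R -> R -> R) a b c d : a <= b -> c <= d ->
  (forall x y, a <= x <= b -> c <= y <= d ->
    [/\ is_derive x 1 (P ^~ y) (p x y), is_derive y 1 (Q x) (q x y),
        differentiable (fun z : R * R => p z.1 z.2) (x, y),
        differentiable (fun z : R * R => q z.1 z.2) (x, y) &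
        'd (fun z : R * R => p z.1 z.2) (x, y) (0, 1) =
        'd (fun z : R * R => q z.1 z.2) (x, y) (1, 0)]) ->
  (P b c - P a c) + (Q b d - Q b c) = (P b d - P a d) + (Q a d - Q a c).
Proof.
move=> ab cd H.
pose A x0 x1 y0 y1 := (P x1 y0 - P x0 y0) + (Q x1 y1 - Q x1 y0)
  - (P x1 y1 - P x0 y1) - (Q x0 y1 - Q x0 y0).
suff : A a b c d = 0 by rewrite /A; lra.
apply: additive_rectangle_eq0 => //; try by move=> *; rewrite /A; ring.
move=> x y xab ycd e e0; have [dP dQ dp dq pq] := H x y xab ycd.
set k := (X in X = _) in pq.
have pk : 'd (fun z : R * R => p z.1 z.2) (x, y) (0, 1) = k by [].
clearbody k.
have e20 : 0 < e / 2 by rewrite divr_gt0.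
have := differentiable_eps dp e20; have := differentiable_eps dq e20.
move=> /nbhs_norm0P[r1 /= r10 q1] /nbhs_norm0P[r2 /= r20 p1].
exists (Num.min r1 r2); first by rewrite lt_min r10 r20.
move=> x0 x1 y0 y1 /andP[ax0 x0x] /andP[xx1 x1b] /andP[cy0 y0y] /andP[yy1 y1d].
rewrite !lt_min => /andP[xr1 xr2] /andP[yr1 yr2].
pose s := x1 - x0 + (y1 - y0).
have s_bound x' y' : x0 <= x' <= x1 -> y0 <= y' <= y1 ->
    `|(x' - x, y' - y) : R * R| < Num.min r1 r2 /\
    `|(x' - x, y' - y) : R * R| <= s.
  move=> /andP[? ?] /andP[? ?].
  have xx : `|x' - x| <= x1 - x0 by rewrite ler_norml; lra.
  have yy : `|y' - y| <= y1 - y0 by rewrite ler_norml; lra.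
  rewrite prod_normE/= gt_max ge_max !lt_min /s; lra.
have near_pt (f : R * R -> R) r : Num.min r1 r2 <= r ->
    (forall t, `|t| < r -> `|f (t + (x, y)) - f (x, y) - 'd f (x, y) t|
       <= e / 2 * `|t|) ->
    forall x' y', x0 <= x' <= x1 -> y0 <= y' <= y1 ->
    `|f (x', y') - f (x, y) - ((x' - x) * 'd f (x, y) (1, 0) +
       (y' - y) * 'd f (x, y) (0, 1))| <= e / 2 * s.
  move=> rr fr x' y' x'x y'y; have [tr ts] := s_bound _ _ x'x y'y.
  have := fr _ (lt_le_trans tr rr); rewrite linear_pairE.
  have -> : (x' - x, y' - y) + (x, y) = (x', y').
    by congr (_, _); rewrite /= subrK.
  by move=> /le_trans; apply; rewrite ler_pM2l.
have {}p1 := near_pt (fun z => p z.1 z.2) r2 ltac:(by rewrite ge_min lexx orbT) p1.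
have {}q1 := near_pt (fun z => q z.1 z.2) r1 ltac:(by rewrite ge_min lexx) q1.
have dist_increments (z z0 z1 l0 l1 : R) :
    `|z0 - z - l0| <= e / 2 * s -> `|z1 - z - l1| <= e / 2 * s ->
    `|z0 - z1 - (l0 - l1)| <= e * s.
  move=> h0 h1; have -> : e * s = e / 2 * s + e / 2 * s by field.
  apply: le_trans (lerD h0 h1); apply: le_trans (ler_normB _ _).
  by rewrite le_eqVlt; apply/orP; left; apply/eqP; congr `|_|; ring.
have x01 := le_trans x0x xx1; have y01 := le_trans y0y yy1.
have s0 : 0 <= s by rewrite addr_ge0// subr_ge0.
have [x00 x11] : x0 <= x0 <= x1 /\ x0 <= x1 <= x1 by rewrite !lexx x01.
have [y00 y11] : y0 <= y0 <= y1 /\ y0 <= y1 <= y1 by rewrite !lexx y01.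
have within_x t : x0 <= t <= x1 -> a <= t <= b.
  by move=> /andP[t0 t1]; rewrite (le_trans ax0 t0) (le_trans t1 x1b).
have within_y t : y0 <= t <= y1 -> c <= t <= d.
  by move=> /andP[t0 t1]; rewrite (le_trans cy0 t0) (le_trans t1 y1d).
(* k (y1 - y0) and - k (x1 - x0) are the first-order terms of the differences of p
   and q across the rectangle; after integration they cancel in A *)
have PE : `|(P x1 y0 - P x1 y1 + k * (y1 - y0) * x1) -
            (P x0 y0 - P x0 y1 + k * (y1 - y0) * x0)| <= e * s * (x1 - x0).
  pose f t := P t y0 - P t y1 + k * (y1 - y0) * t.
  apply: (@increment_bound f (fun t => p t y0 - p t y1 + k * (y1 - y0))) => //.
    move=> t /within_x tab.
    have [d0 _ _ _ _] := H t y0 tab (within_y _ y00).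
    have [d1 _ _ _ _] := H t y1 tab (within_y _ y11).
    by apply: is_derive_eq; rewrite /GRing.scale/= ?mulr1.
  move=> t t01.
  have := dist_increments _ _ _ _ _ (p1 _ y0 t01 y00) (p1 _ y1 t01 y11); rewrite pk /=.
  by congr (`|_| <= _); congr (_ + _); ring.
have QE : `|(Q x1 y1 - Q x0 y1 - k * (x1 - x0) * y1) -
            (Q x1 y0 - Q x0 y0 - k * (x1 - x0) * y0)| <= e * s * (y1 - y0).
  pose f t := Q x1 t - Q x0 t - k * (x1 - x0) * t.
  apply: (@increment_bound f (fun t => q x1 t - q x0 t - k * (x1 - x0))) => //.
    move=> t /within_y tcd.
    have [_ d0 _ _ _] := H x0 t (within_x _ x00) tcd.
    have [_ d1 _ _ _] := H x1 t (within_x _ x11) tcd.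
    by apply: is_derive_eq; rewrite /GRing.scale/= ?mulr1.
  move=> t t01.
  have := dist_increments _ _ _ _ _ (q1 x1 _ x11 t01) (q1 x0 _ x00 t01); rewrite -pq /=.
  by congr (`|_| <= _); congr (_ + _); ring.
have -> : e * s ^+ 2 = e * s * (x1 - x0) + e * s * (y1 - y0) by rewrite /s; ring.
apply: le_trans (lerD PE QE); apply: le_trans (ler_normD _ _).
by rewrite /A le_eqVlt; apply/orP; left; apply/eqP; congr `|_|; ring.
Qed.
End Goursat.

(** * Integrals over circles *)

Section Primitive.
Context {R : realType}.
Local Notation mu := (@lebesgue_measure R).
Implicit Types (a b x : R) (f g : R -> R).

Let clamp a b x := Num.max a (Num.min x b).

(** Clamping extends the integrand from [a, b] to a continuous function, and
    starting at a - 1 puts a in the interior of the domain of integration, so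
    that the derivative at both ends is two-sided. *)
Definition primitive a b f x : R :=
  \int[mu]_(t in `[a - 1, x]) f (clamp a b t).

Lemma is_derive_primitive a b f : a <= b ->
  (forall x, a <= x <= b -> {for x, continuous f}) ->
  forall x, a <= x <= b -> is_derive x 1 (primitive a b f) (f x).
Proof.
move=> ab cf x /andP[ax xb].
have clampE y : a <= clamp a b y <= b by rewrite le_max lexx ge_max ab ge_min lexx orbT.
have cclamp : continuous (f \o clamp a b).
  move=> y; apply: continuous_comp; last exact: cf.
  apply: continuous_max; first exact: cst_continuous.
  by apply: continuous_min => //; exact: cst_continuous.
have [] := @continuous_FTC1_closed R (f \o clamp a b) (a - 1) x (b + 1).
- by rewrite (le_lt_trans xb)// ltrDl.
- apply: continuous_compact_integrable; first exact: segment_compact.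
  exact: continuous_subspaceT.
- by rewrite (lt_le_trans _ ax)// ltrBlDr ltrDl.
- exact: cclamp.
move=> dF F'; apply: DeriveDef; first exact: dF.
rewrite -derive1E F' /= /clamp (min_idPl xb) (max_idPr ax)//.
Qed.

Variable T : R.
Hypothesis T_ge0 : 0 <= T.

Definition period_integral g : R := primitive 0 T g T - primitive 0 T g 0.

Lemma period_integral_dist g g' c M :
  (forall x, 0 <= x <= T -> {for x, continuous g}) ->
  (forall x, 0 <= x <= T -> {for x, continuous g'}) ->
  (forall x, 0 <= x <= T -> `|g x - g' x - c| <= M) ->
  `|period_integral g - period_integral g' - c * T| <= M * T.
Proof.
move=> cg cg' gM.
have dg := is_derive_primitive T_ge0 cg.
have dg' := is_derive_primitive T_ge0 cg'.
pose F x := primitive 0 T g x - primitive 0 T g' x - c * x.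
have := @increment_bound R F (fun x => g x - g' x - c) 0 T M T_ge0 _ gM.
rewrite subr0 (_ : F _ - F _ = period_integral g - period_integral g' - c * T); last first.
  by rewrite /F /period_integral; ring.
apply=> x xT; have gx := dg x xT; have gx' := dg' x xT.
by apply: is_derive_eq; rewrite /GRing.scale/= mulr1.
Qed.

End Primitive.

Section CircleMean.
Context {R : realType}.
Variable T : R.
Hypothesis T_gt0 : 0 < T.
Let T0 : 0 <= T := ltW T_gt0.
Implicit Types (G H : R -> R -> R) (a b r e : R).

Let uncur G := fun z : R * R => G z.1 z.2.

Lemma continuous_slicel G x y : {for (x, y), continuous (uncur G)} ->
  {for x, continuous (G ^~ y)}.
Proof.
move=> cG; have cpair : {for x, continuous (fun x : R => (x, y))}.
  exact/differentiable_continuous/differentiable_pair.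
exact: (continuous_comp cpair cG).
Qed.

Lemma continuous_slicer G x y : {for (x, y), continuous (uncur G)} ->
  {for y, continuous (G x)}.
Proof.
move=> cG; have cpair : {for y, continuous (fun y : R => (x, y))}.
  exact/differentiable_continuous/differentiable_pair.
exact: (continuous_comp cpair cG).
Qed.

Lemma is_diff_fst (z : R * R) : is_diff z (fst : R * R -> R) fst.
Proof.
have cfst : continuous (fst : R * R -> R) by move=> t; exact: cvg_fst.
apply: DiffDef; first exact: (@linear_differentiable _ _ _ fst).
exact: (@diff_lin _ _ _ fst).
Qed.

(** For phi = G + iH holomorphic, written in polar coordinates, this is Goursat's
    theorem for the imaginary part (H / r) dr + G dt of phi dz / z.  The
    contributions of the radii t = 0 and t = T cancel by periodicity. *)
Lemma period_integral_const G H a b : 0 < a -> a <= b ->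
  (forall r t, a <= r <= b -> 0 <= t <= T ->
    [/\ differentiable (uncur G) (r, t), differentiable (uncur H) (r, t) &
        'd (uncur H) (r, t) (0, 1) = r * 'd (uncur G) (r, t) (1, 0)]) ->
  (forall r, a <= r <= b -> H r 0 = H r T) ->
  period_integral T (G b) = period_integral T (G a).
Proof.
move=> a0 ab dGH Hper.
have r_gt0 r : a <= r <= b -> 0 < r by move=> /andP[+ _]; exact: lt_le_trans.
(* the coefficient of dr in the imaginary part of phi dz / z *)
pose p r t := H r t / r.
have dp r t : a <= r <= b -> 0 <= t <= T ->
    is_diff (r, t) (uncur p)
      (H r t *: (- r ^- 2 *: fst) + r^-1 *: ('d (uncur H) (r, t) : R * R -> R)).
  move=> rab tT; have [_ dH _] := dGH r t rab tT.
  have r0 : (fst (r, t)) != 0 by rewrite gt_eqF// r_gt0.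
  have dfst := is_diff_fst (r, t).
  have dV : is_diff (r, t) (fun z : R * R => z.1^-1) (- r ^- 2 *: fst).
    apply: DiffDef; first exact: differentiableV.
    by rewrite (@diffV _ _ (fst : R * R -> R))// diff_val.
  have dHd := differentiableP dH.
  exact: (@is_diffM _ _ (uncur H) (fun z : R * R => z.1^-1)).
have cont (F : R -> R -> R) z : differentiable (uncur F) z -> {for z, continuous (uncur F)}.
  exact: differentiable_continuous.
have [h0 hT] : (0 : R) <= 0 <= T /\ (0 : R) <= T <= T.
  by rewrite !lexx T0.
have [P dP] : exists P : R -> R -> R, forall t, 0 <= t <= T -> forall r, a <= r <= b ->
    is_derive r 1 (P ^~ t) (p r t).
  exists (fun r t => primitive a b (p ^~ t) r) => t tT r rab.
  apply: is_derive_primitive rab => // x xab.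
  by have [/cont/continuous_slicel] := dp x t xab tT.
have dQ r : a <= r <= b -> forall t, 0 <= t <= T ->
    is_derive t 1 (primitive 0 T (G r)) (G r t).
  move=> rab; apply: is_derive_primitive; first exact: T0.
  by move=> t tT; have [/cont/continuous_slicer] := dGH r t rab tT.
have PE : `|(P b T - P b 0) - (P a T - P a 0)| <= 0 * (b - a).
  apply: (@increment_bound R (fun r => P r T - P r 0) (fun r => p r T - p r 0) a b 0 ab) => x xab.
    by have P2 := dP _ hT x xab; have P0 := dP _ h0 x xab; exact: is_deriveB.
  by rewrite /p -(Hper x xab) subrr normr0.
have Pper : P b T - P a T = P b 0 - P a 0.
  by move: PE; rewrite mul0r normr_le0 subr_eq0 => /eqP; lra.
have := @goursat R p G P (fun r => primitive 0 T (G r)) a b 0 T ab T0.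
rewrite /= -/(period_integral T (G b)) -/(period_integral T (G a)) Pper => gours.
suff : P b 0 - P a 0 + period_integral T (G b) =
    P b 0 - P a 0 + period_integral T (G a) by exact: addrI.
apply: gours => r t rab tT; have [dG dH HG] := dGH r t rab tT.
have [dpr dpE] := dp r t rab tT.
split=> //; first exact: dP.
  exact: dQ.
rewrite dpE !fctE/= HG scaler0 scaler0 add0r.
by rewrite /GRing.scale/= mulKf// gt_eqF// r_gt0.
Qed.

(** On the compact interval [0, T] the continuity of G in r is uniform in t. *)
Lemma period_integral_continuous (D : set R) G r : D r ->
  (forall r' t, D r' -> 0 <= t <= T -> {for (r', t), continuous (uncur G)}) ->
  forall e, 0 < e ->
  \forall r' \near r, D r' -> `|period_integral T (G r') - period_integral T (G r)| <= e * T.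
Proof.
move=> Dr cG e e0.
have near_t : forall t, `[0, T]%classic t ->
    \forall t' \near t & r' \near r, 0 <= t' <= T -> `|G r' t' - G r t'| <= e.
  move=> t; rewrite /= in_itv/= => tT.
  have e20 : 0 < e / 2 by rewrite divr_gt0.
  have cGrt := cG r t Dr tT.
  have /cvgrPdist_le/(_ _ e20) := cGrt.
  move=> [[U V] /= [rU tV] UV].
  have rUr := nbhs_singleton rU.
  exists (V, U) => //= -[t' r'] /= [Vt' Ur'] _.
  have := UV (r', t') (conj Ur' Vt'); have := UV (r, t') (conj rUr Vt').
  rewrite /uncur /= => h1 h2.
  have := le_trans (ler_normB _ _) (lerD h1 h2).
  rewrite -splitr; apply: le_trans; rewrite le_eqVlt; apply/orP; left.
  by apply/eqP; congr `|_|; ring.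
have /compact_near_coveringP cov := @segment_compact R 0 T.
have {}cov := cov R (nbhs r) (fun r' t' => 0 <= t' <= T -> `|G r' t' - G r t'| <= e)
  (nbhs_filter r) near_t.
apply: (filterS _ cov) => r' /= Hr' Dr'.
have := @period_integral_dist R T T0 (G r') (G r) 0 e; rewrite mul0r subr0; apply=> t tT.
- exact/continuous_slicer/cG.
- exact/continuous_slicer/cG.
by rewrite subr0; apply: Hr' => //=; rewrite in_itv.
Qed.

(** At the radius s of a removable singularity only the continuity of G is known.
    The integral is constant on both sides of s, hence throughout, by continuity,
    and it is zero at the radius 0. *)
Lemma period_integral_eq0 G H s rho : 0 < s < rho ->
  (forall r t, 0 <= r <= rho -> 0 <= t <= T -> {for (r, t), continuous (uncur G)}) ->
  (forall r t, 0 < r <= rho -> r != s -> 0 <= t <= T ->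
    [/\ differentiable (uncur G) (r, t), differentiable (uncur H) (r, t) &
        'd (uncur H) (r, t) (0, 1) = r * 'd (uncur G) (r, t) (1, 0)]) ->
  (forall r, H r 0 = H r T) -> (forall t, G 0 t = 0) ->
  period_integral T (G rho) = 0.
Proof.
move=> /andP[s0 srho] cG dGH Hper G0.
have rho0 := lt_trans s0 srho.
have cD r t : `[0, rho]%classic r -> 0 <= t <= T -> {for (r, t), continuous (uncur G)}.
  by rewrite /= in_itv/=; exact: cG.
have integral_near r e : 0 <= r <= rho -> 0 < e -> exists2 d, 0 < d &
    forall r', 0 <= r' <= rho -> `|r - r'| < d ->
    `|period_integral T (G r') - period_integral T (G r)| <= e * T.
  move=> rrho e0; have Dr : `[0, rho]%classic r by rewrite /= in_itv.
  have /nbhs_ballP[d /= d0 dP] := period_integral_continuous Dr cD e0.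
  by exists d => // r' r'rho rr'; apply: dP => //=; rewrite in_itv.
have integral0 : period_integral T (G 0) = 0.
  have -> : G 0 = fun=> 0 by apply/funext.
  apply/eqP; rewrite -normr_le0.
  have dprim := @is_derive_primitive R 0 T (fun=> 0) T0.
  have := @increment_bound R _ (fun=> 0) 0 T 0 T0 (dprim _).
  by rewrite mul0r; apply=> [x _|x _]; [exact: cst_continuous|rewrite normr0].
apply/eqP; rewrite -normr_le0; apply/ler_addgt0Pl => e e0; rewrite addr0.
pose e' := e / (3 * T).
have e'0 : 0 < e' by rewrite divr_gt0// mulr_gt0.
have [srho' zrho] : 0 <= s <= rho /\ 0 <= (0 : R) <= rho.
  by rewrite lexx !ltW.
have [d d0 ds] := integral_near s e' srho' e'0.
have [d' d'0 dz] := integral_near 0 e' zrho e'0.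
(* radii just above s, just below s and near 0 *)
pose r1 := s + Num.min (d / 2) (rho - s).
pose r2 := s - Num.min (d / 2) (s / 2).
pose r3 := Num.min (d' / 2) r2.
have [r1s r1rho dr1] : [/\ s < r1, r1 <= rho & `|s - r1| < d].
  rewrite /r1; case: (leP (d / 2) (rho - s)) => h; split; try lra.
    by rewrite ltr_norml; lra.
  by rewrite ltr_norml; lra.
have [r20 r2s dr2] : [/\ 0 < r2, r2 < s & `|s - r2| < d].
  rewrite /r2; case: (leP (d / 2) (s / 2)) => h; split; try lra.
    by rewrite ltr_norml; lra.
  by rewrite ltr_norml; lra.
have [r30 r32 dr3] : [/\ 0 < r3, r3 <= r2 & `|0 - r3| < d'].
  rewrite /r3; case: (leP (d' / 2) r2) => h; split; try lra.
    by rewrite ltr_norml; lra.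
  by rewrite ltr_norml; lra.
have E1 : period_integral T (G rho) = period_integral T (G r1).
  apply: (@period_integral_const G H) => //; first exact: lt_trans r1s.
  move=> r t /andP[r1r rrho]; apply: dGH.
    by rewrite rrho (lt_le_trans _ r1r)// (lt_trans s0).
  by rewrite gt_eqF// (lt_le_trans r1s).
have E2 : period_integral T (G r2) = period_integral T (G r3).
  apply: (@period_integral_const G H) => //.
  move=> r t /andP[r3r rr2]; apply: dGH.
    by rewrite (lt_le_trans r30 r3r) ltW// (le_lt_trans rr2)// (lt_trans r2s).
  by rewrite lt_eqF// (le_lt_trans rr2).
have h1 := ds r1 ltac:(by rewrite r1rho ltW// (lt_trans s0)) dr1.
have h2 := ds r2 ltac:(by rewrite !ltW// (lt_trans r2s)) dr2.
have h3 := dz r3 ltac:(by rewrite !ltW// (le_lt_trans r32)// (lt_trans r2s)) dr3.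
rewrite integral0 subr0 -E2 in h3; rewrite E1.
have -> : period_integral T (G r1) = (period_integral T (G r1) - period_integral T (G s))
    - (period_integral T (G r2) - period_integral T (G s)) + period_integral T (G r2).
  by ring.
have eE : e = e' * T + e' * T + e' * T.
  by rewrite /e'; field; rewrite gt_eqF.
rewrite eE (le_trans (ler_normD _ _))// lerD// (le_trans (ler_normB _ _))// lerD//.
Qed.

End CircleMean.

(** * Complex derivatives in polar coordinates *)

Section ComplexDerivative.
Context {K : numFieldType}.

(** Over an abstract field, to which the rules of differentiation apply; the
    field of complex numbers is substituted afterwards. *)
Definition cderivable (f : K -> K) (z : K) : Prop := derivable f z 1.

Lemma cderivable_eps (f : K -> K) z : cderivable f z -> exists d, forall e, 0 < e ->
  exists2 r, 0 < r & forall k, `|k| < r -> `|f (k + z) - f z - k * d| <= e * `|k|.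
Proof.
move=> /derivable1_diffP df; exists ('d f z 1) => e e0.
have /nbhs_norm0P[r /= r0 rP] := differentiable_eps df e0.
exists r => // k kr; have := rP k kr.
by rewrite -[X in 'd f z X]mulr1 linearZ.
Qed.

Definition ccontinuous (f : K -> K) (z : K) : Prop := {for z, continuous f}.

Lemma ccontinuous_eps (f : K -> K) z : ccontinuous f z <-> forall e, 0 < e ->
  exists2 r, 0 < r & forall k, `|k| < r -> `|f (k + z) - f z| < e.
Proof.
have fE := @cvgrPdist_lt K K^o K (nbhs z) (nbhs_filter z) f (f z).
split=> [/fE fz e e0|fz].
  have /nbhs_normP[r /= r0 rP] := fz e e0.
  exists r => // k kr; rewrite distrC; apply: rP => /=.
  by rewrite opprD addrCA subrr addr0 normrN.
apply/fE => e e0; have [r r0 rP] := fz e e0.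
apply/nbhs_normP; exists r => // k /= kr.
by rewrite distrC -(subrK z k); apply: rP; rewrite distrC.
Qed.

Lemma cderivable_continuous (f : K -> K) z : cderivable f z -> ccontinuous f z.
Proof. by move=> /derivable1_diffP/differentiable_continuous. Qed.

End ComplexDerivative.

Section Polar.
Context {R : realType}.
Local Notation C := R[i].
Local Notation normc := ComplexField.Normc.normc.
Implicit Types (f : C -> C) (z w : C).

Lemma normcE z : `|z| = (normc z)%:C. Proof. by []. Qed.

Lemma Re_le_normc z : `|complex.Re z| <= normc z.
Proof. by rewrite -lecR -normcE normc_ge_Re. Qed.

Lemma Im_le_normc z : `|complex.Im z| <= normc z.
Proof.
case: z => a b /=; rewrite -sqrtr_sqr ler_wsqrtr// lerDr sqr_ge0 //.
Qed.

Lemma normc_le_ReIm z : normc z <= `|complex.Re z| + `|complex.Im z|.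
Proof.
case: z => a b /=; rewrite -[leRHS]ger0_norm ?addr_ge0//.
rewrite -sqrtr_sqr ler_wsqrtr// sqrrD !real_normK ?num_real// lerD2r.
by rewrite lerDl mulrn_wge0// mulr_ge0.
Qed.

Lemma cderivable_epsc f z : cderivable f z -> exists d : C, forall e : R, 0 < e ->
  exists2 r : R, 0 < r & forall k, normc k < r ->
    normc (f (k + z) - f z - k * d) <= e * normc k.
Proof.
move=> /cderivable_eps[d dP]; exists d => e e0.
have [|r r0 rP] := dP e%:C; first by rewrite ltcR.
have /complex_realP[s rE] := gtr0_real r0; subst r.
rewrite ltcR in r0; exists s => // k ks.
by have := rP k; rewrite !normcE ltcR -rmorphM/= lecR; apply.
Qed.

Definition polar (r t : R) : C := (r * cos t) +i* (r * sin t).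

Lemma normc_polar r t : 0 <= r -> normc (polar r t) = r.
Proof.
move=> r0; rewrite /= !exprMn -mulrDr cos2Dsin2 mulr1 sqrtr_sqr ger0_norm//.
Qed.

Lemma is_diff_snd (z : R * R) : is_diff z (snd : R * R -> R) snd.
Proof.
have csnd : continuous (snd : R * R -> R) by move=> t; exact: cvg_snd.
apply: DiffDef; first exact: (@linear_differentiable _ _ _ snd).
exact: (@diff_lin _ _ _ snd).
Qed.

Let cart (z : R * R) : C := z.1 +i* z.2.

Lemma is_diff_linear_form (a b : R) (z : R * R) : is_diff z
   (a *: (fst : R * R -> R) + b *: (snd : R * R -> R))
   (a *: (fst : R * R -> R) + b *: (snd : R * R -> R)).
Proof.
by have f1 := is_diff_fst z; have f2 := is_diff_snd z; exact: is_diffD.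
Qed.

(** Here h is the real or the imaginary part, and a, b are the entries of the
    corresponding row of the real matrix of multiplication by d. *)
Lemma is_diff_real_part (h : C -> R) (a b : R) f (d : C) (z : R * R) :
  (forall u v, h (u - v) = h u - h v) -> (forall u, `|h u| <= normc u) ->
  (forall k : R * R, h (cart k * d) = a * k.1 + b * k.2) ->
  (forall e : R, 0 < e -> exists2 r : R, 0 < r & forall k, normc k < r ->
    normc (f (k + cart z) - f (cart z) - k * d) <= e * normc k) ->
  is_diff z (h \o f \o cart) (a *: (fst : R * R -> R) + b *: (snd : R * R -> R)).
Proof.
move=> hB h_le hd fd; have [dL LE] := is_diff_linear_form a b z.
rewrite -LE; apply: is_diff_eps; first exact: diff_continuous.
move=> e e0; have e20 : 0 < e / 2 by rewrite divr_gt0.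
have [r r0 rP] := fd _ e20.
apply/nbhs_norm0P; exists (r / 2) => /=; first by rewrite divr_gt0.
move=> k kr; rewrite LE !fctE /GRing.scale /= -hd -!hB.
have kk : normc (cart k) <= 2 * `|k|.
  apply: le_trans (normc_le_ReIm _) _; rewrite mulr_natl mulr2n prod_normE/=.
  by rewrite lerD// le_max lexx ?orbT.
have -> : cart (k + z) = cart k + cart z by [].
apply: le_trans (h_le _) _; apply: le_trans (rP _ _) _.
  by rewrite (le_lt_trans kk)// mulrC -ltr_pdivlMr.
by rewrite -ler_pdivlMl// invf_div mulrA divfK ?gt_eqF//.
Qed.

Let dpolar (r t : R) (z : R * R) : R * R :=
  (z.1 * cos t - r * sin t * z.2, z.1 * sin t + r * cos t * z.2).

Lemma is_diff_polar r t :
  is_diff (r, t) (fun z : R * R => (z.1 * cos z.2, z.1 * sin z.2)) (dpolar r t).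
Proof.
have d1 := is_diff_fst (r, t); have d2 := is_diff_snd (r, t).
have dder (f df : R -> R) (x : R) :
    is_derive x (1 : R) f (df x) -> is_diff x f (fun k : R => k *: df x : R).
  move=> [dfx <-]; apply: DiffDef; first exact/derivable1_diffP.
  by rewrite deriv1E// derive1E.
have dc := @dder cos (fun x => - sin x) t (is_derive_cos t).
have ds := @dder sin cos t (is_derive_sin t).
have dcs := @is_diff_comp _ _ _ _ snd snd cos _ (r, t) d2 dc.
have dss := @is_diff_comp _ _ _ _ snd snd sin _ (r, t) d2 ds.
have dX := is_diffM d1 dcs; have dY := is_diffM d1 dss.
have [dXY XYE] := is_diff_pair dX dY; apply: DiffDef; first exact: dXY.
rewrite [LHS]XYE; apply/funext => z.
by rewrite /dpolar !fctE /GRing.scale /=; congr (_, _); ring.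
Qed.

(** The last clause is the Cauchy-Riemann equation in polar coordinates. *)
Lemma polar_differentiable f r t : cderivable f (polar r t) ->
  let G (z : R * R) := complex.Re (f (polar z.1 z.2)) in
  let H (z : R * R) := complex.Im (f (polar z.1 z.2)) in
  [/\ differentiable G (r, t), differentiable H (r, t) &
      'd H (r, t) (0, 1) = r * 'd G (r, t) (1, 0)].
Proof.
move=> /cderivable_epsc[d dP] G H.
pose E (z : R * R) : R * R := (z.1 * cos z.2, z.1 * sin z.2).
have dE : is_diff (r, t) E _ := is_diff_polar r t.
have dG : is_diff (E (r, t)) (@complex.Re R \o f \o cart)
   (complex.Re d *: (fst : R * R -> R) + (- complex.Im d) *: (snd : R * R -> R)).
  apply: is_diff_real_part dP; [by case=> ? ? []|exact: Re_le_normc|].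
  by case: (d) => a b [x y] /=; ring.
have dH : is_diff (E (r, t)) (@complex.Im R \o f \o cart)
   (complex.Im d *: (fst : R * R -> R) + complex.Re d *: (snd : R * R -> R)).
  apply: is_diff_real_part dP; [by case=> ? ? []|exact: Im_le_normc|].
  by case: (d) => a b [x y] /=; ring.
have [dGE GE] := is_diff_comp dE dG; have [dHE HE] := is_diff_comp dE dH.
split; [exact: dGE|exact: dHE|].
rewrite [LHS](congr1 (fun F => F _) HE) [X in _ * X](congr1 (fun F => F _) GE).
by rewrite /dpolar !fctE /GRing.scale /=; ring.
Qed.

Lemma polar_continuous (h : C -> R) f r t :
  (forall u v, h (u - v) = h u - h v) -> (forall u, `|h u| <= normc u) ->
  ccontinuous f (polar r t) ->
  {for (r, t), continuous (fun z : R * R => h (f (polar z.1 z.2)))}.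
Proof.
move=> hB h_le /ccontinuous_eps fc; apply/cvgrPdist_lt => e e0.
have [|d d0 dP] := fc e%:C; first by rewrite ltcR.
have /complex_realP[s dE] := gtr0_real d0; subst d; rewrite ltcR in d0.
pose E (z : R * R) : R * R := (z.1 * cos z.2, z.1 * sin z.2).
have cE : {for (r, t), continuous E}.
  exact/differentiable_continuous/(@ex_diff _ _ _ _ _ _ _ (is_diff_polar r t)).
have d20 : 0 < s / 2 by rewrite divr_gt0.
have /cvgrPdist_lt/(_ _ d20) := cE.
apply: filterS => z zE; rewrite -hB (le_lt_trans (h_le _))//.
rewrite -(opprB (f (polar z.1 z.2))) normcN.
rewrite -(subrK (polar r t) (polar z.1 z.2)) -ltcR -normcE; apply: dP.
rewrite normcE ltcR (le_lt_trans (normc_le_ReIm _))//.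
move: zE; rewrite prod_normE /= gt_max distrC (distrC (r * sin t)) => /andP[zc zs].
by rewrite [ltRHS]splitr ltrD.
Qed.

End Polar.

(** * Rigidity of flat holomorphic functions *)

Section CauchyQuotientDerivable.
Context {K : numFieldType}.
Implicit Types (k f : K -> K) (z w d : K).

(** If d is the derivative of k at z, then the value at z is the limit. *)
Definition cauchy_quotient k z d w : K :=
  if w == z then d * z else (k w - k z) * w / (w - z).

Lemma cderivable_cauchy_quotient k z d w :
  cderivable k w -> w != z -> cderivable (cauchy_quotient k z d) w.
Proof.
move=> dk wz.
apply: (@near_eq_derivable _ _ _ (fun w => (k w - k z) * w / (w - z))).
  have : \forall w' \near w, w' != z.
    apply/nbhs_normP; exists `|w - z|; first by rewrite /= normr_gt0 subr_eq0.
    by move=> w' /= ww'; apply: contraTneq ww' => ->; rewrite ltxx.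
  by apply: filterS => w' w'z; rewrite /cauchy_quotient (negbTE w'z).
have dB c (g : K -> K) : derivable g w 1 -> derivable (fun w => g w - c) w 1.
  by move=> dg; apply: derivableB => //; exact: derivable_cst.
have did : derivable (fun w : K => w) w 1 by exact: derivable_id.
apply: (@derivableM _ _ (fun w => (k w - k z) * w) (fun w => (w - z)^-1)).
  by apply: (@derivableM _ _ (fun w => k w - k z) (fun w => w)) => //; exact: dB.
by apply: derivableV; [rewrite subr_eq0|exact: dB].
Qed.

Lemma cderivable_divX f n w : cderivable f w -> w != 0 ->
  cderivable (fun w => f w / w ^+ n) w.
Proof.
move=> df w0.
apply: (@derivableM _ _ f (fun w => (w ^+ n)^-1)) => //.
by apply: derivableV; [rewrite expf_neq0|exact: exprn_derivable].
Qed.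

Lemma cderivableZ f c w : cderivable f w -> cderivable (fun w => c * f w) w.
Proof. by move=> df; apply: (@derivableM _ _ (cst c) f) => //; exact: derivable_cst. Qed.

End CauchyQuotientDerivable.

Section Flat.
Context {R : realType}.
Local Notation C := R[i].
Local Notation normc := ComplexField.Normc.normc.
Implicit Types (f k : C -> C) (z w : C).

Lemma normcM z w : normc (z * w) = normc z * normc w.
Proof. exact: ComplexField.Normc.normcM. Qed.

Lemma normcV z : normc z^-1 = (normc z)^-1.
Proof. exact: ComplexField.Normc.normcV. Qed.

Lemma normcX z n : normc (z ^+ n) = normc z ^+ n.
Proof.
elim: n => [|n IH]; first by rewrite !expr0 ComplexField.Normc.normc1.
by rewrite !exprS normcM IH.
Qed.

Lemma normc_ge0 z : 0 <= normc z.
Proof. by rewrite -lecR -normcE normr_ge0. Qed.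

Lemma normc_gt0 z : (0 < normc z) = (z != 0).
Proof. by rewrite -ltcR -normcE normr_gt0. Qed.

Lemma ler_normcD z w : normc (z + w) <= normc z + normc w.
Proof. exact: le_normcD. Qed.

Lemma ler_normcB z w : normc (z - w) <= normc z + normc w.
Proof. by rewrite -(normcN w) ler_normcD. Qed.

Lemma lerB_normcD z w : normc z - normc w <= normc (z + w).
Proof. by rewrite lerBlDr -(normcN w) (le_trans _ (ler_normcD _ _))// addrK. Qed.

Lemma lerB_normcB z w : normc z - normc w <= normc (z - w).
Proof. by rewrite -(normcN w) lerB_normcD. Qed.

Lemma ccontinuous_epsc f z : (forall e : R, 0 < e -> exists2 r : R, 0 < r &
    forall h, normc h < r -> normc (f (h + z) - f z) < e) -> ccontinuous f z.
Proof.
move=> fz; apply/ccontinuous_eps => e e0.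
have /complex_realP[s eE] := gtr0_real e0; subst e; rewrite ltcR in e0.
have [r r0 rP] := fz s e0; exists r%:C; first by rewrite ltcR.
by move=> h; rewrite !normcE !ltcR; exact: rP.
Qed.

Lemma ccontinuous_cauchy_quotient k z d :
  (forall e : R, 0 < e -> exists2 r : R, 0 < r & forall h, normc h < r ->
    normc (k (h + z) - k z - h * d) <= e * normc h) ->
  ccontinuous (cauchy_quotient k z d) z.
Proof.
move=> dk; apply: ccontinuous_epsc => e e0.
have nz := normc_ge0 z; have nd := normc_ge0 d.
have e1 : 0 < e / (2 * (normc z + 1)) by rewrite divr_gt0// mulr_gt0// ltr_wpDl.
have [r r0 rP] := dk _ e1.
exists (Num.min (Num.min r 1) (e / (2 * (normc d + 1)))).
  by rewrite !lt_min r0 ltr01 divr_gt0// mulr_gt0// ltr_wpDl.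
move=> h; rewrite !lt_min => /andP[/andP[hr h1] hd].
rewrite /cauchy_quotient eqxx; case: ifPn => [_|]; first by rewrite subrr ComplexField.Normc.normc0.
rewrite -subr_eq0 addrK => h0.
have -> : (k (h + z) - k z) * (h + z) / h - d * z =
    (k (h + z) - k z - h * d) / h * (h + z) + h * d by field.
apply: le_lt_trans (ler_normcD _ _) _; rewrite [ltRHS]splitr ltr_leD//; last first.
  rewrite normcM (@le_trans _ _ (normc h * (normc d + 1)))//.
    by rewrite ler_wpM2l ?normc_ge0// lerDl.
  move: hd; rewrite invfM mulrA ltr_pdivlMr ?ltr_wpDl//; exact: ltW.
have nh : 0 < normc h by rewrite normc_gt0.
rewrite !normcM normcV.
apply: (@le_lt_trans _ _ (e / (2 * (normc z + 1)) * normc (h + z))).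
  by rewrite ler_wpM2r ?normc_ge0// ler_pdivrMr//; exact: rP.
have -> : e / 2 = e / (2 * (normc z + 1)) * (normc z + 1).
  by field; rewrite gt_eqF// ltr_wpDl.
by rewrite ltr_pM2l// (le_lt_trans (ler_normcD _ _))// addrC ltrD2l.
Qed.

Lemma ccontinuous0_cauchy_quotient k z d B r : z != 0 -> 0 < r ->
  (forall w, normc w < r -> normc (k w) <= B) ->
  ccontinuous (cauchy_quotient k z d) 0.
Proof.
move=> z0 r0 kB; apply: ccontinuous_epsc => e e0.
have nz : 0 < normc z by rewrite normc_gt0.
have B0 : 0 <= B.
  by rewrite (le_trans (normc_ge0 (k 0)))// kB// ComplexField.Normc.normc0.
pose D := B + normc (k z) + 1.
have nkz := normc_ge0 (k z).
have D0 : 0 < D by rewrite /D; lra.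
exists (Num.min (Num.min r (normc z / 2)) (e * normc z / (2 * D))).
  by rewrite !lt_min r0 !divr_gt0// mulr_gt0.
move=> w; rewrite !lt_min => /andP[/andP[wr wz] we].
rewrite addr0 /cauchy_quotient [0 == z]eq_sym (negbTE z0) mulr0 mul0r subr0.
case: ifPn => [/eqP wE|wNz]; first by move: wz; rewrite wE; lra.
rewrite !normcM normcV.
have h1 : normc z / 2 <= normc (w - z).
  by rewrite -(normcN (w - z)) opprB (le_trans _ (lerB_normcB _ _))//; lra.
have h2 : normc (k w - k z) <= D.
  by rewrite (le_trans (ler_normcB _ _))// /D; have := kB w wr; lra.
rewrite ltr_pdivrMr; last by rewrite (lt_le_trans _ h1)// divr_gt0.
have h3 : D * normc w < e * (normc z / 2).
  rewrite -ltr_pdivlMl// (lt_le_trans we)// le_eqVlt; apply/orP; left; apply/eqP.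
  by field; rewrite gt_eqF.
apply: le_lt_trans (lt_le_trans h3 _); last by rewrite ler_pM2l.
by rewrite ler_wpM2r// normc_ge0.
Qed.

Lemma polar_per r : polar r 0 = polar r (2 * pi) :> C.
Proof. by rewrite /polar cos0 sin0 mulr_natl cos2pi sin2pi. Qed.

Lemma polar0 t : polar 0 t = 0 :> C.
Proof. by rewrite /polar !mul0r. Qed.

Section TaylorStep.
Variables (f : C -> C) (n : nat) (r B : R).
Hypothesis r0 : 0 < r.
Hypothesis df : forall z, normc z <= r -> cderivable f z.
Hypothesis f1 : forall z, normc z <= r -> normc (f z) <= 1.
Hypothesis fB : forall z, normc z <= r / 5 -> normc (f z) <= B * normc z ^+ n.

Let k w := f w / w ^+ n.

Let dk w : normc w <= r -> w != 0 -> cderivable k w.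
Proof. by move=> wr w0; apply: cderivable_divX => //; exact: df. Qed.

Let kB w : normc w < r / 5 -> normc (k w) <= B.
Proof.
move=> /ltW wr; have B0 : 0 <= B.
  have r50 : 0 <= r / 5 by rewrite divr_ge0// ltW.
  have := fB (z := (r / 5)%:C); have -> : normc (r / 5)%:C = r / 5.
    by rewrite /= expr0n/= addr0 sqrtr_sqr ger0_norm.
  move=> /(_ (lexx _)) h; have := le_trans (normc_ge0 _) h.
  by rewrite pmulr_lge0// exprn_gt0// divr_gt0.
rewrite normcM normcV normcX; have [->|wn0] := eqVneq (normc w ^+ n) 0.
  by rewrite invr0 mulr0.
rewrite ler_pdivrMr; first exact: fB.
by rewrite lt_neqAle eq_sym wn0 exprn_ge0// normc_ge0.
Qed.

Let T : R := 2 * pi.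
Let T0 : 0 < T. Proof. by rewrite mulr_gt0// pi_gt0. Qed.

Let polar_r_neq0 t : polar r t != 0.
Proof. by rewrite -normc_gt0 normc_polar// ltW. Qed.

(** Cauchy's formula for k = f / w^n, which is bounded near 0.  The quotient
    (k w - k z) w / (w - z) is continuous at z and vanishes at 0, so its
    integral over the circle of radius r is 0.  As w / (w - z) = 1 + z / (w - z),
    the value k z differs from the mean of k, which does not depend on z, by at
    most a multiple of |z|. *)
Lemma re_quotient_near_period_integral : exists a : R, forall z, z != 0 -> normc z <= r / 5 ->
  `|complex.Re (f z / z ^+ n) - a| <=
    5 / (4 * r) * normc z * (r ^- n + normc (f z / z ^+ n)).
Proof.
exists (period_integral T (fun t => complex.Re (k (polar r t))) / T) => z z0 zr5.
rewrite -/(k z).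
have nz : 0 < normc z by rewrite normc_gt0.
have zr : normc z < r by lra.
have [d dP] := cderivable_epsc (dk (ltW zr) z0).
pose phi := cauchy_quotient k z d.
have dphi w : normc w <= r -> w != 0 -> w != z -> cderivable phi w.
  by move=> wr w0; apply: cderivable_cauchy_quotient; exact: dk.
have cphi w : normc w <= r -> ccontinuous phi w.
  move=> wr; have [->|w0] := eqVneq w 0.
    by apply: ccontinuous0_cauchy_quotient kB => //; rewrite divr_gt0.
  have [->|wz] := eqVneq w z; first exact: ccontinuous_cauchy_quotient.
  by apply: cderivable_continuous; exact: dphi.
have ReB (u v : C) : complex.Re (u - v) = complex.Re u - complex.Re v by case: u v => ? ? [].
have cG x t : 0 <= x <= r ->
    {for (x, t), continuous (fun y : R * R => complex.Re (phi (polar y.1 y.2)))}.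
  move=> /andP[x0 xr]; apply: polar_continuous => //; first exact: Re_le_normc.
  by apply: cphi; rewrite normc_polar.
have integral0 : period_integral T (fun t => complex.Re (phi (polar r t))) = 0.
  apply: (@period_integral_eq0 R T T0 (fun x t => complex.Re (phi (polar x t)))
    (fun x t => complex.Im (phi (polar x t))) (normc z)).
  - by rewrite nz zr.
  - by move=> x t xr _; exact: cG.
  - move=> x t /andP[x0 xr] xz _; apply: polar_differentiable.
    have np := normc_polar t (ltW x0).
    apply: dphi; rewrite ?np//; first by rewrite -normc_gt0 np.
    by apply: contraNneq xz => <-; rewrite np.
  - by move=> x; rewrite polar_per.
  - by move=> t; rewrite polar0 /phi /cauchy_quotient eq_sym (negbTE z0) mulr0 mul0r.
have rr : 0 <= r <= r by rewrite lexx ltW.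
set M := (X in _ <= X).
have := @period_integral_dist R T (ltW T0) (fun t => complex.Re (phi (polar r t)))
  (fun t => complex.Re (k (polar r t))) (- complex.Re (k z)) M.
rewrite integral0 => bnd.
have cg' t : {for t, continuous (fun t => complex.Re (k (polar r t)))}.
  apply: (@continuous_slicer R (fun x t => complex.Re (k (polar x t)))).
  apply: (@polar_continuous R (@complex.Re R) k r t) => //; first exact: Re_le_normc.
  apply/cderivable_continuous/dk; last exact: polar_r_neq0.
  by rewrite normc_polar// ltW.
have cg t : {for t, continuous (fun t => complex.Re (phi (polar r t)))}.
  exact: (@continuous_slicer R (fun x t => complex.Re (phi (polar x t))) r t (cG r t rr)).
have {bnd} : `|0 - period_integral T (fun t => complex.Re (k (polar r t)))
    - (- complex.Re (k z)) * T| <= M * T.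
  apply: bnd => t _; [exact: cg|exact: cg'|].
  - set w := polar r t; have nw : normc w = r by rewrite normc_polar// ltW.
    have wz : w - z != 0.
      by rewrite subr_eq0; apply: contraTneq zr => <-; rewrite nw ltxx.
    have -> : complex.Re (phi w) - complex.Re (k w) - - complex.Re (k z) =
        complex.Re (phi w - (k w - k z)) by rewrite !ReB; ring.
    have -> : phi w - (k w - k z) = (k w - k z) * z / (w - z).
      rewrite /phi /cauchy_quotient -subr_eq0 (negbTE wz).
      by move: (k w) (k z) => kw kz; field.
    apply: le_trans (Re_le_normc _) _; rewrite !normcM normcV.
    have wz45 : 4 / 5 * r <= normc (w - z).
      by rewrite (le_trans _ (lerB_normcB _ _))// nw; lra.
    have r45 : 0 < 4 / 5 * r by rewrite mulr_gt0// divr_gt0.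
    have kw : normc (k w) <= r ^- n.
      rewrite normcM normcV normcX nw ler_piMl//.
        by rewrite invr_ge0 exprn_ge0// ltW.
      by apply: f1; rewrite nw.
    rewrite ler_pdivrMr ?(lt_le_trans r45)//.
    apply: (@le_trans _ _ ((r ^- n + normc (k z)) * normc z)).
      rewrite ler_wpM2r ?normc_ge0// (le_trans (ler_normcB _ _))//.
      by rewrite lerD2r.
    have nkz := normc_ge0 (k z).
    apply: (@le_trans _ _ (M * (4 / 5 * r))).
      rewrite le_eqVlt; apply/orP; left; apply/eqP; rewrite /M.
      by move: (r ^- n) => rn; field; rewrite gt_eqF.
    have M0 : 0 <= M.
      apply: mulr_ge0; first by rewrite mulr_ge0 ?normc_ge0// divr_ge0// mulr_ge0// ltW.
      by rewrite addr_ge0// invr_ge0 exprn_ge0// ltW.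
    by rewrite ler_wpM2l.
have -> : 0 - period_integral T (fun t => complex.Re (k (polar r t))) - - complex.Re (k z) * T =
   (complex.Re (k z) - period_integral T (fun t => complex.Re (k (polar r t))) / T) * T.
  by field; rewrite gt_eqF.
by rewrite normrM (gtr0_norm T0) ler_pM2r.
Qed.

(** Along the positive axis f / z^n tends to 0, so the mean is 0. *)
Lemma re_quotient_small : (exists c d : R, 0 < d /\
    forall t, 0 < t < d -> normc (f t%:C) <= c * t ^+ n.+1) ->
  forall z, z != 0 -> normc z <= r / 5 ->
  `|complex.Re (f z / z ^+ n)| <=
    5 / (4 * r) * normc z * (r ^- n + normc (f z / z ^+ n)).
Proof.
have [a aP] := re_quotient_near_period_integral.
move=> [c [d [d0 cd]]] z z0 zr; rewrite -[X in Num.norm X]subr0.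
suff -> : 0 = a by exact: aP.
apply/esym/eqP; rewrite -normr_le0; apply/ler_addgt0Pl => e e0; rewrite addr0.
have rn : 0 < r ^- n by rewrite invr_gt0 exprn_gt0.
have r4 : 0 < 5 / (4 * r) by rewrite divr_gt0// mulr_gt0.
have c0 : 0 <= c.
  have d20 : 0 < d / 2 by rewrite divr_gt0.
  have := cd (d / 2) ltac:(by rewrite d20; lra).
  by move/(le_trans (normc_ge0 _)); rewrite pmulr_lge0// exprn_gt0.
(* at t <= 1 the two available bounds add up to at most t * D *)
pose D := c + 5 / (4 * r) * (r ^- n + c).
have D0 : 0 < D by rewrite ltr_wpDl// mulr_gt0// ltr_wpDr.
pose t := Num.min (Num.min (d / 2) 1) (Num.min (r / 5) (e / D)).
have t0 : 0 < t by rewrite !lt_min !divr_gt0//= ltr01.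
have [td t1 tr te] : [/\ t <= d / 2, t <= 1, t <= r / 5 & t <= e / D].
  by rewrite /t !ge_min !lexx ?orbT.
have nt : normc t%:C = t by rewrite /= expr0n/= addr0 sqrtr_sqr gtr0_norm.
have t0' : t%:C != 0 by rewrite -normc_gt0 nt.
have kt : normc (f t%:C / t%:C ^+ n) <= c * t.
  rewrite normcM normcV normcX nt ler_pdivrMr ?exprn_gt0// -mulrA -exprS.
  by apply: cd; rewrite t0; lra.
have := aP _ t0' ltac:(by rewrite nt); rewrite nt => h.
have h2 := Re_le_normc (f t%:C / t%:C ^+ n).
move: (complex.Re _) h h2 => x h h2.
have h3 : `|a| <= `|x| + `|x - a|.
  by rewrite -[X in `|X| <= _](subKr x) ler_normB.
apply: (le_trans h3); apply: (@le_trans _ _ (t * D)); last first.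
  by rewrite -ler_pdivlMr.
rewrite (_ : t * D = c * t + 5 / (4 * r) * t * (r ^- n + c)); last by rewrite /D; ring.
rewrite lerD//; first exact: le_trans kt.
apply: (le_trans h); rewrite (ler_pM2l (mulr_gt0 r4 t0)) lerD2l (le_trans kt)//.
by rewrite ler_piMr.
Qed.

End TaylorStep.

(** By induction: the bound for n says that f / z^n is bounded near 0, and the
    estimate of its real part gains a factor |z| / r.  The imaginary part is the
    real part of - i f / z^n.  As the constant 5 is the same for all n, the
    function f is zero for |z| < r / 5. *)
Lemma flat_holomorphic_bound f r : 0 < r ->
  (forall z, normc z <= r -> cderivable f z) ->
  (forall z, normc z <= r -> normc (f z) <= 1) -> f 0 = 0 ->
  (forall n, exists c d : R, 0 < d /\
    forall t, 0 < t < d -> normc (f t%:C) <= c * t ^+ n) ->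
  forall n z, normc z <= r / 5 -> normc (f z) <= 5 * r ^- n * normc z ^+ n.
Proof.
move=> r0 df f1 f0 flat; elim=> [|n IH] z zr.
  by rewrite !expr0 invr1 !mulr1 (le_trans (f1 _ _))// ?ler1n//; lra.
have ni : normc ((0 -i* 1) : C) = 1 by rewrite /= expr0n/= add0r sqrrN expr1n sqrtr1.
have [->|z0] := eqVneq z 0.
  by rewrite f0 ComplexField.Normc.normc0 expr0n/= mulr0.
(* the real part of g is the imaginary part of f *)
pose g w := (0 -i* 1) * f w.
have ng w : normc (g w) = normc (f w) by rewrite normcM ni mul1r.
have fre := re_quotient_small r0 df f1 IH (flat n.+1) z0 zr.
have dg w : normc w <= r -> cderivable g w by move=> wr; exact/cderivableZ/df.
have g1 w : normc w <= r -> normc (g w) <= 1 by move=> wr; rewrite ng f1.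
have gB w : normc w <= r / 5 -> normc (g w) <= 5 * r ^- n * normc w ^+ n.
  by move=> wr; rewrite ng IH.
have gflat : exists c d : R, 0 < d /\
    forall t, 0 < t < d -> normc (g t%:C) <= c * t ^+ n.+1.
  by have [c [d [d0 cd]]] := flat n.+1; exists c, d; split => // t td; rewrite (ng t%:C); exact: cd.
have gre := re_quotient_small r0 dg g1 gB gflat z0 zr.
have gE : complex.Re (g z / z ^+ n) = complex.Im (f z / z ^+ n).
  by rewrite /g -mulrA; case: (_ / _) => x y /=; ring.
have ngE : normc (g z / z ^+ n) = normc (f z / z ^+ n) by rewrite normcM ng normcM.
rewrite gE ngE in gre.
have nz : 0 < normc z by rewrite normc_gt0.
have := normc_le_ReIm (f z / z ^+ n) => h.
have {}h := le_trans h (lerD fre gre).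
have fE : normc (f z) = normc (f z / z ^+ n) * normc z ^+ n.
  by rewrite normcM normcV normcX divfK// expf_neq0// gt_eqF.
rewrite fE [normc z ^+ n.+1]exprS mulrA ler_pM2r ?exprn_gt0//.
have K0 := normc_ge0 (f z / z ^+ n).
move: (normc (f z / z ^+ n)) h K0 => K h K0.
rewrite exprS invfM; set rn := r ^- n in h *.
pose x := normc z / r.
have x5 : x <= 1 / 5 by rewrite ler_pdivrMr// mulrC mulrA mulr1.
have hx : K <= 5 / 2 * (x * rn) + 5 / 2 * (x * K).
  apply: (le_trans h); rewrite le_eqVlt; apply/orP; left; apply/eqP.
  by rewrite /x; field; rewrite gt_eqF.
have xK : x * K <= 1 / 5 * K by rewrite ler_wpM2r.
have -> : 5 * (r^-1 * rn) * normc z = 5 * (x * rn) by rewrite /x; ring.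
lra.
Qed.

End Flat.

(** * A smooth function flat at the origin *)

Section FlatFunction.
Context {R : realType}.
Implicit Types (t : R) (k n m : nat).

(** The case k = 0 is the smooth function with zero Taylor series; the powers of
    1 / t close the family under differentiation. *)
Definition flat k t : R := if 0 < t then expR (- t^-1) / t ^+ k else 0.

Lemma flat_ge0 k t : 0 <= flat k t.
Proof.
by rewrite /flat; case: ifP => // t0; rewrite divr_ge0 ?expR_ge0 ?exprn_ge0// ltW.
Qed.

(** From exp (1 / t) >= (1 / t)^j / j! with j = k + m + 1. *)
Lemma flat_le k m t : 0 < t -> flat k t <= (k + m).+1`!%:R * (t * t ^+ m).
Proof.
move=> t0; rewrite /flat t0 ler_pdivrMr ?exprn_gt0//.
have -> : (k + m).+1`!%:R * (t * t ^+ m) * t ^+ k = (k + m).+1`!%:R * t ^+ (k + m).+1.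
  by rewrite exprS exprD; ring.
have := expR_ge1Dxn (k + m) (ltW (_ : 0 < t^-1)); rewrite invr_gt0 => /(_ t0) h.
rewrite expRN -[leRHS]invrK.
rewrite lef_pV2 ?posrE ?expR_gt0 ?invr_gt0 ?mulr_gt0 ?exprn_gt0 ?ltr0n ?fact_gt0//.
apply: le_trans h; rewrite invfM exprVn mulrC -[leLHS]add0r lerD2r//.
Qed.

Lemma is_derive_flat k t : is_derive t 1 (flat k) (flat k.+2 t - k%:R * flat k.+1 t).
Proof.
have [t0|t0|->] := ltgtP t 0.
- have -> : flat k.+2 t - k%:R * flat k.+1 t = 0.
    by rewrite /flat ltNge (ltW t0)/= mulr0 subrr.
  have d0 : is_derive t 1 (cst (0 : R)) (0 : R) by exact: is_derive_cst.
  apply: near_eq_is_derive d0; near=> s => /=; rewrite /flat ltNge (_ : s <= 0)//; apply/ltW.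
  by near: s; exact: lt_nbhsl.
- have tN0 : t != 0 by rewrite gt_eqF.
  have dinv : is_derive t 1 (fun s : R => - s^-1) (t ^- 2).
    have := @is_deriveV R id t 1 1 tN0 (is_derive_id _ _).
    by move=> /is_deriveN; rewrite [_ *: _]mulr1 opprK; exact.
  have dexp : is_derive t 1 (fun s : R => expR (- s^-1)) (expR (- t^-1) * t ^- 2).
    exact: (@is_derive1_comp _ expR (fun s : R => - s^-1)).
  have dpow : is_derive t 1 (fun s : R => (s ^+ k)^-1) (- (k%:R / t ^+ k.+1)).
    have dX : is_derive t 1 (fun s : R => s ^+ k) (k%:R * t ^+ k.-1).
      apply: DeriveDef; first exact: exprn_derivable.
      by rewrite exp_derive /GRing.scale /= mulr1.
    apply: is_derive_eq (@is_deriveV R (fun s : R => s ^+ k) t _ 1 (expf_neq0 k tN0) dX) _.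
    rewrite /GRing.scale /=; case: k {dX} => [|k]; first by rewrite !mul0r mulr0 oppr0.
    by rewrite /= !exprS; field; rewrite ?expf_neq0//.
  have dM := @is_deriveM _ _ _ _ _ _ _ _ dexp dpow.
  apply: is_derive_eq (near_eq_is_derive _ dM) _.
    near=> s; rewrite /flat (_ : 0 < s)//.
    by near: s; exact: lt_nbhsr.
  rewrite /flat t0 /GRing.scale /= !exprS.
  by field; rewrite expf_neq0// tN0.
- have -> : flat k.+2 0 - k%:R * flat k.+1 0 = 0 by rewrite /flat ltxx mulr0 subrr.
  have cvg0 : (fun h => h^-1 *: ((flat k \o shift 0) (h *: 1) - flat k 0)) @ 0^' --> (0 : R).
    have c0 : 0 < (k + 1).+1`!%:R :> R by rewrite ltr0n fact_gt0.
    apply/cvgrPdist_le => e e0; near=> s.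
    rewrite /= sub0r normrN addr0 [s *: 1]mulr1 [flat k 0]/flat ltxx subr0.
    have [s0|s0] := leP s 0.
      by rewrite /flat ltNge s0 scaler0 normr0 ltW.
    rewrite ger0_norm; last by rewrite mulr_ge0 ?flat_ge0// invr_ge0 ltW.
    rewrite [_ *: _]mulrC ler_pdivrMr// (le_trans (flat_le k 1 s0))// expr1.
    rewrite mulrA ler_pM2r// -ler_pdivlMl// mulrC.
    have : `|s| <= e / (k + 1).+1`!%:R by near: s; apply: dnbhs0_le; rewrite divr_gt0.
    by rewrite gtr0_norm.
  by apply: DeriveDef; [apply/cvg_ex; exists 0|exact: cvg_lim cvg0].
Unshelve. all: by end_near. Qed.

End FlatFunction.

(** * Annihilators and linear forms *)

Section Annihilator.
Context {K : fieldType} {N : nat}.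

Lemma annihilator_matrix (h : {vspace 'rV[K]_N}) :
  exists M : 'M[K]_(N - \dim h, N), row_free M /\ forall Z, Z \in h -> Z *m M^T = 0.
Proof.
pose B := \matrix_(i < \dim h) (vbasis h)`_i.
have Bfree : row_free B.
  apply: inj_row_free => v; rewrite mulmx_sum_row => vB.
  have /freeP fr := basis_free (vbasisP h).
  apply/rowP => i; rewrite mxE; apply: (fr (fun i => v 0 i)); rewrite -[RHS]vB.
  by apply: eq_bigr => j _; rewrite rowK.
have rkB : \rank B = \dim h by apply/eqP.
have rkK : \rank (kermx B^T) = (N - \dim h)%N by rewrite mxrank_ker mxrank_tr rkB.
suff : exists M : 'M[K]_(\rank (kermx B^T), N), row_free M /\ M *m B^T = 0.
  rewrite rkK => -[M [Mfree MB]]; exists M; split => // Z /coord_vbasis ->.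
  rewrite mulmx_suml big1// => i _; rewrite -scalemxAl.
  have -> : (vbasis h)`_i = row i B by rewrite rowK.
  by rewrite -row_mul -[B]trmxK -trmx_mul MB trmx0 row0 scaler0.
exists (row_base (kermx B^T)); split; first exact: row_base_free.
by apply/sub_kermxP; rewrite eq_row_base.
Qed.

End Annihilator.

Section LinearForm.
Context {R : realType} {N : nat}.
Implicit Types (xi v w x : 'rV[R]_N).

Definition lin xi v : R := (v *m xi^T) 0 0.

Lemma linE xi v : lin xi v = \sum_k v 0 k * xi 0 k.
Proof. by rewrite /lin mxE; apply: eq_bigr => k _; rewrite mxE. Qed.

Lemma linD xi v w : lin xi (v + w) = lin xi v + lin xi w.
Proof. by rewrite /lin mulmxDl mxE. Qed.

Lemma linZ xi a v : lin xi (a *: v) = a * lin xi v.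
Proof. by rewrite /lin -scalemxAl mxE. Qed.

Lemma lin0 xi : lin xi 0 = 0. Proof. by rewrite /lin mul0mx mxE. Qed.

Lemma differentiable_lin xi x : differentiable (lin xi) x.
Proof.
have -> : lin xi = \sum_k (fun v : 'rV[R]_N => v 0 k * xi 0 k : R).
  by apply/funext => v; rewrite fct_sumE linE.
apply: differentiable_sum => k.
by apply: differentiableM; [exact: differentiable_coord|exact: differentiable_cst].
Qed.

Lemma derive_lin xi x w : 'D_w (lin xi) x = lin xi w.
Proof.
apply/lim_near_cst => //=; near=> s; rewrite linD linZ addrK /GRing.scale /=.
by rewrite mulKf//; near: s; exact: nbhs_dnbhs_neq.
Unshelve. all: by end_near. Qed.

Lemma differentiable_flat k (t : R) : differentiable (flat k) t.
Proof. by apply/derivable1_diffP; have [] := is_derive_flat k t. Qed.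

Lemma differentiable_flat_lin k xi x : differentiable (flat k \o lin xi) x.
Proof. exact: differentiable_comp (differentiable_lin xi x) (differentiable_flat k _). Qed.

Lemma derive_flat_lin k xi x w : 'D_w (flat k \o lin xi) x =
  lin xi w * (flat k.+2 (lin xi x) - k%:R * flat k.+1 (lin xi x)).
Proof.
rewrite (deriveE _ (differentiable_flat_lin k xi x)).
rewrite (diff_comp (differentiable_lin xi x) (differentiable_flat k _)).
rewrite /= -(deriveE _ (differentiable_lin xi x)) derive_lin.
rewrite diff1E ?derive1E; last exact: differentiable_flat.
by have [_ ->] := is_derive_flat k (lin xi x).
Qed.

Lemma CkZ n (U : set 'rV[R]_N) f (c : R) : open U ->
  Ck n U f -> Ck n U (fun x => c * f x).
Proof.
move=> oU; elim: n f => [|n IH] f.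
  move=> cf x Ux; have cc : {for x, continuous (cst c : 'rV[R]_N -> R)} by exact: cst_continuous.
  exact: (continuousM cc (cf x Ux)).
move=> [df Df]; split=> [x Ux|v].
  by apply: (@differentiableM _ _ (cst c) f) => //; exact: df.
apply: Ck_eq oU _ (IH _ (Df v)) => x Ux.
by rewrite -deriveMl//; apply: diff_derivable; exact: df.
Qed.

Lemma Ck_lin n (U : set 'rV[R]_N) xi : Ck n U (lin xi).
Proof.
case: n => [|n] /=.
  by move=> x _; apply/differentiable_continuous/differentiable_lin.
split=> [x _|v]; first exact: differentiable_lin.
rewrite (_ : 'D_v _ = fun=> lin xi v); first exact: Ck_cst.
by apply/funext => x; rewrite derive_lin.
Qed.

Lemma Ck_flat_lin n (U : set 'rV[R]_N) k xi : open U -> Ck n U (flat k \o lin xi).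
Proof.
move=> oU; elim: n k => [|n IH] k.
  by move=> x _; apply/differentiable_continuous/differentiable_flat_lin.
split=> [x _|v]; first exact: differentiable_flat_lin.
apply: (@Ck_eq _ _ _ _ (fun x => lin xi v *
   ((flat k.+2 \o lin xi) x - k%:R * (flat k.+1 \o lin xi) x)) _ oU).
  by move=> x _; rewrite derive_flat_lin.
by apply: (CkZ _ oU); apply: (CkB oU (IH _)); apply: (CkZ _ oU); exact: IH.
Qed.

End LinearForm.

(** * Logarithmic charts of the torus *)

Section Chart.
Context {R : realType} {N : nat} {T : torus R N}.
Local Notation C := R[i].
Implicit Types (v w : 'rV[R]_N) (x y : T).

Lemma in_chartD (f : T -> C) x v w :
  in_chart f (x + torus_exp T v) w = in_chart f x (v + w).
Proof. by rewrite /in_chart raddfD addrA. Qed.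

Lemma derive_shift0 (g : 'rV[R]_N -> R) v w :
  'D_w (fun u => g (v + u)) 0 = 'D_w g v.
Proof.
suff E : (fun s : R => s^-1 *: (((fun u => g (v + u)) \o shift 0) (s *: w) - g (v + 0))) =
    (fun s : R => s^-1 *: ((g \o shift v) (s *: w) - g v)) by rewrite /derive E.
by apply/funext => s /=; rewrite !addr0 (addrC v).
Qed.

Lemma vfieldR_chart (f : T -> C) x v w :
  vfieldR w f (x + torus_exp T v) =
    'D_w (@complex.Re R \o in_chart f x) v +i* 'D_w (@complex.Im R \o in_chart f x) v.
Proof.
have E (g : C -> R) :
    'D_w (g \o in_chart f (x + torus_exp T v)) 0 = 'D_w (g \o in_chart f x) v.
  rewrite -(derive_shift0 (g \o in_chart f x)).
  suff -> : g \o in_chart f (x + torus_exp T v) = fun u => (g \o in_chart f x) (v + u) by [].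
  by apply/funext => u; rewrite /= in_chartD.
by rewrite /vfieldR !E.
Qed.

Variable U : set 'rV[R]_N.
Hypotheses (oU : open U) (U0 : U 0) (injU : set_inj U (torus_exp T)).

Definition torus_log y : 'rV[R]_N := xget 0 [set v | U v /\ torus_exp T v = y].

Lemma torus_expK v : U v -> torus_log (torus_exp T v) = v.
Proof.
move=> Uv; rewrite /torus_log; case: xgetP => [w _ [Uw ew]|/(_ v)[]//].
by apply: injU; rewrite ?inE.
Qed.

Lemma nbhs_exp : nbhs (0 : T) (torus_exp T @` U).
Proof.
apply: open_nbhs_nbhs; split; first exact: torus_exp_open.
by exists 0 => //; rewrite raddf0.
Qed.

Lemma in_chart_log (F : 'rV[R]_N -> C) v : U v ->
  in_chart (F \o torus_log) (0 : T) v = F v.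
Proof. by move=> Uv; rewrite /in_chart add0r /= torus_expK. Qed.

Lemma smooth_near_log (F : 'rV[R]_N -> C) :
  (forall n, Ck n U (@complex.Re R \o F) /\ Ck n U (@complex.Im R \o F)) ->
  smooth_near (F \o torus_log) (0 : T).
Proof.
move=> FC; exists U; first by split.
move=> n; have [FR FI] := FC n.
by split; [apply: Ck_eq oU _ FR|apply: Ck_eq oU _ FI] => v Uv /=; rewrite in_chart_log.
Qed.

Lemma vfieldR_log (F : 'rV[R]_N -> C) v w : U v ->
  vfieldR w (F \o torus_log) (torus_exp T v : T) =
    'D_w (@complex.Re R \o F) v +i* 'D_w (@complex.Im R \o F) v.
Proof.
move=> Uv; rewrite -[X in vfieldR _ _ X]add0r vfieldR_chart.
have nU : nbhs v U by exact: open_nbhs_nbhs.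
congr (_ +i* _); apply: near_eq_derive; apply: filterS nU => u Uu /=;
  by rewrite in_chart_log.
Qed.

End Chart.

(** * Hypocomplexity forbids real annihilators *)

Section HolomorphicLine.

Lemma holomorphic_near0_line (K : numFieldType) m (F : 'rV[K]_m -> K) a :
  holomorphic_near0 F -> exists2 r, 0 < r &
    forall z, `|z| < r -> cderivable (fun z => F (z *: a)) z.
Proof.
move=> dF; suff /nbhs_norm0P[r r0 rP] : \forall z \near (0 : K), cderivable (fun z => F (z *: a)) z.
  by exists r => // z /rP.
have : \forall z \near (0 : K), differentiable F (z *: a).
  have := @scalel_continuous K _ a (0 : K); rewrite /continuous_at scale0r.
  by move/(_ _ dF).
apply: filterS => z dz; apply/derivable1_diffP.
exact: (@differentiable_comp _ _ _ _ (fun z : K => z *: a) F).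
Qed.

Context {R : realType}.
Local Notation C := R[i].
Local Notation normc := ComplexField.Normc.normc.

Lemma near0_normc (P : C -> Prop) : (exists2 d : C, 0 < d & forall z, `|z| < d -> P z) ->
  exists2 r : R, 0 < r & forall z, normc z <= r -> P z.
Proof.
move=> [d d0 dP].
have /complex_realP[s dE] := gtr0_real d0; subst d; rewrite ltcR in d0.
exists (s / 2); first by rewrite divr_gt0.
move=> z zs; apply: dP => /=; rewrite normcE ltcR (le_lt_trans zs)//; lra.
Qed.

(** At a point 0 < t <= r / 10 the bounds of [flat_holomorphic_bound] would give
    flat 0 t <= 5 / 2^n for every n. *)
Lemma flat_not_holomorphic (f : C -> C) :
  (exists2 d : C, 0 < d & forall z, `|z| < d -> cderivable f z) ->
  (\forall t \near (0 : R), f t%:C = (flat 0 t)%:C) -> False.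
Proof.
move=> df ft.
have f0 : f 0 = 0 by rewrite (nbhs_singleton ft) /flat ltxx.
have [r1 r10 dr1] := near0_normc df.
have [r2 r20 fr2] : exists2 r : R, 0 < r & forall z, normc z <= r -> normc (f z) <= 1.
  have df0 : cderivable f 0 by apply: dr1; rewrite ComplexField.Normc.normc0 ltW.
  have /ccontinuous_eps/(_ 1 ltr01)[d d0 dP] := cderivable_continuous df0.
  apply: near0_normc; exists d => // z /dP.
  by rewrite addr0 f0 subr0 normcE ltcR => /ltW.
have [s /= s0 sP] : exists2 s : R, 0 < s & forall t, `|t| < s -> f t%:C = (flat 0 t)%:C.
  by have /nbhs_norm0P[s s0 sP] := ft; exists s => // t /sP.
pose r := Num.min r1 r2.
have r0 : 0 < r by rewrite lt_min r10 r20.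
have nreal (t : R) : 0 <= t -> normc t%:C = t.
  by move=> t0; rewrite /= expr0n/= addr0 sqrtr_sqr ger0_norm.
have bound := @flat_holomorphic_bound R f r r0.
pose t := Num.min (r / 10) (s / 2).
have [t0 tr ts] : [/\ 0 < t, t <= r / 10 & t <= s / 2].
  by rewrite /t lt_min !ge_min !lexx ?orbT !divr_gt0.
have df' z : normc z <= r -> cderivable f z.
  by move=> zr; apply: dr1; rewrite (le_trans zr)// ge_min lexx.
have f1' z : normc z <= r -> normc (f z) <= 1.
  by move=> zr; apply: fr2; rewrite (le_trans zr)// ge_min lexx orbT.
have nf x : 0 < x < s -> normc (f x%:C) = flat 0 x.
  by move=> /andP[x0 xs]; rewrite sP ?gtr0_norm// nreal ?flat_ge0.
have flat' k : exists c d : R, 0 < d /\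
    forall x, 0 < x < d -> normc (f x%:C) <= c * x ^+ k.
  case: k => [|k].
    exists 1, s; split=> // x xs; have /andP[x0 _] := xs; rewrite (nf x xs).
    by rewrite expr0 mulr1 /flat x0 expr0 divr1 expR_le1 oppr_le0 invr_ge0 ltW.
  exists (0 + k).+1`!%:R, s; split=> // x xs; have /andP[x0 _] := xs; rewrite (nf x xs).
  by rewrite exprS; exact: flat_le.
have {}bound n : flat 0 t <= 5 * r ^- n * t ^+ n.
  have ht : normc t%:C <= r / 5 by rewrite nreal ?ltW//; lra.
  have := bound df' f1' f0 flat' n t%:C ht.
  have ts' : 0 < t < s by rewrite t0/=; lra.
  by rewrite (nf t ts') (nreal t (ltW t0)).
have ft0 : 0 < flat 0 t by rewrite /flat t0 expr0 divr1 expR_gt0.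
have tr1 : t / r <= 2^-1 by rewrite ler_pdivrMr//; lra.
have bound2 n : 2 ^+ n * flat 0 t <= 5.
  have h : flat 0 t <= 5 * 2 ^- n.
    apply: (le_trans (bound n)); rewrite -mulrA ler_pM2l// mulrC -expr_div_n -exprVn.
    by rewrite lerXn2r ?nnegrE ?invr_ge0// divr_ge0// ltW.
  by rewrite mulrC -ler_pdivlMr// exprn_gt0.
have := truncnS_gt (5 / flat 0 t); set n := (Num.trunc _).+1 => hn.
have := bound2 n; rewrite leNgt => /negP; apply.
rewrite -ltr_pdivrMr// (lt_le_trans hn)// -natrX ler_nat.
exact/ltnW/ltn_expl.
Qed.

End HolomorphicLine.

Section NoRealAnnihilator.
Context {R : realType} {N : nat} (T : torus R N).
Local Notation C := R[i].

Definition clin (c : 'rV[C]_N) (v : 'rV[R]_N) : C :=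
  lin (map_mx (@complex.Re R) c) v +i* lin (map_mx (@complex.Im R) c) v.

Lemma clinE c v : clin c v = (map_mx (real_complex R) v *m c^T) 0 0.
Proof.
rewrite /clin !linE mxE.
transitivity (\sum_k (v 0 k * complex.Re (c 0 k) +i* (v 0 k * complex.Im (c 0 k)))).
  under [in LHS]eq_bigr do rewrite mxE.
  under [X in _ +i* X]eq_bigr do rewrite mxE.
  by elim/big_rec3: _ => // k y1 y2 y3 _ <-.
by apply: eq_bigr => k _; rewrite !mxE; case: (c 0 k) => a b /=; congr (_ +i* _); ring.
Qed.

Lemma clinZ c (t : R) v : clin c (t *: v) = t%:C * clin c v.
Proof. by rewrite /clin !linZ; congr (_ +i* _); rewrite /=; ring. Qed.

Lemma clin0 c : clin c 0 = 0.
Proof. by rewrite /clin !lin0. Qed.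

(** The decomposition Z = X + i Y used in the definition of [vfield]. *)
Lemma complex_rowE (Z : 'rV[C]_N) :
  Z = map_mx (real_complex R) (map_mx (@complex.Re R) Z)
      + (0 +i* 1) *: map_mx (real_complex R) (map_mx (@complex.Im R) Z).
Proof.
apply/rowP => k; rewrite !mxE; case: (Z 0 k) => a b /=.
by congr (_ +i* _); rewrite /=; ring.
Qed.

Variable U : set 'rV[R]_N.
Hypotheses (oU : open U) (injU : set_inj U (torus_exp T)).
Local Notation log := (@torus_log R N T U).

Lemma vfield_clin c Z v : U v ->
  vfield Z (clin c \o log) (torus_exp T v : T) = (Z *m c^T) 0 0.
Proof.
move=> Uv.
have E w : vfieldR w (clin c \o log) (torus_exp T v : T) = clin c w.
  by rewrite (vfieldR_log oU injU)// !derive_lin.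
by rewrite /vfield !E !clinE [in RHS](complex_rowE Z) mulmxDl -scalemxAl !mxE.
Qed.

Lemma vfield_flat xi Z v : U v ->
  lin xi (map_mx (@complex.Re R) Z) = 0 -> lin xi (map_mx (@complex.Im R) Z) = 0 ->
  vfield Z ((fun v => (flat 0 (lin xi v))%:C) \o log) (torus_exp T v : T) = 0.
Proof.
move=> Uv Z1 Z2; rewrite /vfield !(vfieldR_log oU injU)//.
have -> : @complex.Im R \o (fun v => (flat 0 (lin xi v))%:C) = cst 0 by [].
have -> : @complex.Re R \o (fun v => (flat 0 (lin xi v))%:C) = flat 0 \o lin xi by [].
by rewrite !derive_flat_lin Z1 Z2 !derive_cst !mul0r mulr0 addr0.
Qed.

End NoRealAnnihilator.

(** A real annihilator xi makes flat 0 (lin xi (log y)) a solution.  On the line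
    spanned by xi the linear first integrals are multiples of the coordinate t, so
    the holomorphic function of them that represents this solution restricts to a
    germ of one variable equal to flat 0 t at real t. *)
Lemma hypocomplex_no_real_annihilator {R : realType} {N : nat} (T : torus R N)
    (h : {vspace 'rV[R[i]]_N}) (xi : 'rV[R]_N) : hypocomplex T h ->
  (forall Z, Z \in h -> lin xi (map_mx (@complex.Re R) Z) = 0 /\
                        lin xi (map_mx (@complex.Im R) Z) = 0) ->
  xi = 0.
Proof.
move=> [_ hypo] xih; apply: contrapT => /eqP xi0.
have [V V0 injV] := torus_exp_locinj T.
pose U := interior V.
have oU : open U by exact: open_interior.
have U0 : U 0 by [].
have injU : set_inj U (torus_exp T).
  by move=> v w; rewrite !inE => /interior_subset Vv /interior_subset Vw; apply: injV; rewrite inE.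
have [M [Mfree Mh]] := annihilator_matrix h.
have mulE (Z : 'rV[R[i]]_N) j : (Z *m (row j M)^T) 0 0 = (Z *m M^T) 0 j.
  by rewrite !mxE; apply: eq_bigr => k _; rewrite !mxE.
pose log := @torus_log R N T U.
pose F j := clin (row j M) \o log.
have nexp := @nbhs_exp R N T U oU U0.
have log0 : log 0 = 0.
  by rewrite -[X in log X](raddf0 (torus_exp T)) /log (torus_expK injU).
have smoothF j : smooth_near (F j) (0 : T).
  by apply: (smooth_near_log oU U0 injU) => n; split; exact: Ck_lin.
have FI : first_integrals_near h F (0 : T).
  split=> [j|].
    split => //; apply: filterS nexp => _ [v Uv <-] Z Zh.
    by rewrite (vfield_clin oU injU)// mulE Mh// mxE.
  apply: filterS nexp => _ [v Uv <-]; rewrite /independent_differentials.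
  rewrite (_ : \matrix_(_, _) _ = M)//; apply/matrixP => j k; rewrite mxE.
  by rewrite (vfield_clin oU injU)// mulE -rowE !mxE.
have F0 j : F j (0 : T) = 0 by rewrite /F /= log0 clin0.
pose f := (fun v => (flat 0 (lin xi v))%:C) \o log.
have fsol : solution_near h f (0 : T).
  split.
    apply: (smooth_near_log oU U0 injU) => n; split; last exact: Ck_cst.
    exact: (@Ck_flat_lin _ _ n U 0 xi oU).
  apply: filterS nexp => _ [v Uv <-] Z /xih[Z1 Z2].
  exact: (vfield_flat oU injU).
have [H Hhol fH] := hypo 0 F FI F0 f fsol.
pose e := (lin xi xi)^-1 *: xi.
have xixi : lin xi xi != 0.
  apply: contraNneq xi0 => /eqP; rewrite linE psumr_eq0 => [/allP xi0|k _]; last first.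
    by rewrite -expr2 sqr_ge0.
  apply/eqP/rowP => k; have := xi0 k (mem_index_enum _).
  by rewrite mulf_eq0 orbb mxE => /eqP.
have e1 : lin xi e = 1 by rewrite linZ mulVf.
(* F maps the real line of e into the complex line of a *)
pose a := \row_j clin (row j M) e.
apply: (@flat_not_holomorphic R (fun z => H (z *: a))).
  exact: holomorphic_near0_line.
have te0 : (fun t : R => t *: e) @ (0 : R) --> (0 : 'rV[R]_N).
  by have := @scalel_continuous R _ e (0 : R); rewrite /continuous_at scale0r.
have ete0 : (fun t : R => torus_exp T (t *: e) : T) @ (0 : R) --> (0 : T).
  have := @torus_exp_continuous _ _ T 0; rewrite /continuous_at raddf0.
  exact: cvg_trans (cvg_app _ te0).
have nU : nbhs (0 : 'rV[R]_N) U by exact: open_nbhs_nbhs.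
have h1 : \forall t \near (0 : R), U (t *: e) := te0 _ nU.
have h2 : \forall t \near (0 : R), f (torus_exp T (t *: e)) =
    H (\row_j F j (torus_exp T (t *: e))) := ete0 _ fH.
near=> t.
have Ut : U (t *: e) by near: t.
have ft : f (torus_exp T (t *: e)) = H (\row_j F j (torus_exp T (t *: e))) by near: t.
have logt : log (torus_exp T (t *: e)) = t *: e by exact: torus_expK.
have fE : f (torus_exp T (t *: e)) = (flat 0 t)%:C by rewrite /f /= logt linZ e1 mulr1.
rewrite -fE ft; congr (H _).
by apply/rowP => j; rewrite !mxE /F /= logt (clinZ _ t).
Unshelve. all: by end_near. Qed.

(** * The gradient bound *)

Section SmoothEuclidean.
Context {R : realType} {N : nat}.
Implicit Types (g : 'rV[R]_N -> R) (u v w x : 'rV[R]_N) (U : set 'rV[R]_N).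

Definition smooth g := forall n, Ck n setT g.

Lemma smooth_differentiable g x : smooth g -> differentiable g x.
Proof. by move=> /(_ 1%N)[+ _]; exact. Qed.

Lemma smooth_continuous g : smooth g -> continuous g.
Proof. by move=> sg x; exact/differentiable_continuous/smooth_differentiable. Qed.

Lemma smooth_derive g v : smooth g -> smooth ('D_v g).
Proof. by move=> sg n; have [_] := sg n.+1; exact. Qed.

Lemma derive_translate g u v x : 'D_v (fun y => g (u + y)) x = 'D_v g (u + x).
Proof.
rewrite -(derive_shift0 (fun y => g (u + y))) -(derive_shift0 g).
by congr ('D_v _ 0); apply/funext => y; rewrite addrA.
Qed.

Lemma Ck_translate n U g u : Ck n U (fun y => g (u + y)) -> Ck n [set x | U (x - u)] g.
Proof.
have shift_diff x : differentiable (fun y : 'rV[R]_N => y - u) x by exact: differentiableB.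
elim: n g => [|n IH] g.
  move=> cg x /= Ux.
  have cs : {for x, continuous (fun y : 'rV[R]_N => y - u)} by exact/differentiable_continuous.
  have := continuous_comp cs (cg _ Ux).
  by rewrite (_ : _ \o _ = g)//; apply/funext => y /=; rewrite addrC subrK.
move=> [dg Dg]; split=> [x /= Ux|v].
  have := differentiable_comp (shift_diff x) (dg _ Ux).
  by rewrite (_ : _ \o _ = g)//; apply/funext => y /=; rewrite addrC subrK.
apply: IH; have := Dg v; congr Ck; apply/funext => y.
by rewrite derive_translate.
Qed.

Lemma Ck_local n g : (forall x, exists2 U, open_nbhs x U & Ck n U g) -> Ck n setT g.
Proof.
elim: n g => [|n IH] g gl.
  by move=> x _; have [U [oU Ux]] := gl x; exact.
split=> [x _|v]; first by have [U [oU Ux] [dg _]] := gl x; exact: dg.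
by apply: IH => x; have [U xU [_ Dg]] := gl x; exists U => //; exact: Dg.
Qed.

Lemma is_derive_line g x v (s : R) : smooth g ->
  is_derive s 1 (fun s => g (x + s *: v)) ('D_v g (x + s *: v)).
Proof.
move=> sg; have dg := @diff_derivable _ _ _ g _ v (smooth_differentiable (x + s *: v) sg).
have E : (fun t : R => t^-1 *: (((fun s => g (x + s *: v)) \o shift s) (t *: 1)
    - g (x + s *: v))) =
    (fun t : R => t^-1 *: ((g \o shift (x + s *: v)) (t *: v) - g (x + s *: v))).
  apply/funext => t /=; congr (_ *: (g _ - _)).
  by rewrite [t *: 1]mulr1 scalerDl addrCA.
by apply: DeriveDef; rewrite /derivable /derive E.
Qed.

Lemma mvt_line g x v (s : R) : smooth g -> 0 < s ->
  exists2 t, 0 <= t <= s & g (x + s *: v) - g x = s * 'D_v g (x + t *: v).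
Proof.
move=> sg s0.
have cg : {within `[0, s], continuous (fun s => g (x + s *: v))}.
  by apply: derivable_within_continuous => t _; have [] := is_derive_line x v t sg.
have [t] := MVT_segment (ltW s0) (fun t _ => is_derive_line x v t sg) cg.
rewrite in_itv/= subr0 scale0r addr0 => t0s E; exists t => //.
by rewrite E mulrC.
Qed.

(** Schwarz's theorem.  Two mean value steps identify the second difference over
    a small parallelogram with either mixed derivative at some nearby point. *)
Lemma derive_comm g v w x : smooth g -> 'D_v ('D_w g) x = 'D_w ('D_v g) x.
Proof.
move=> sg; have sv := smooth_derive v sg; have sw := smooth_derive w sg.
have second_difference v' w' (s : R) : 0 < s -> exists t t',
    [/\ 0 <= t <= s, 0 <= t' <= s &
     g (x + s *: w' + s *: v') - g (x + s *: v') - (g (x + s *: w') - g x) =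
     s * (s * 'D_w' ('D_v' g) (x + (t *: v' + t' *: w')))].
  move=> s0.
  (* the mean value theorem in the direction v', then in the direction w' *)
  pose d (t : R) := g (x + s *: w' + t *: v') - g (x + t *: v').
  pose d' (t : R) := 'D_v' g (x + s *: w' + t *: v') - 'D_v' g (x + t *: v').
  have dd (t : R) : is_derive t (1 : R) d (d' t).
    have h1 := is_derive_line (x + s *: w') v' t sg.
    by have h2 := is_derive_line x v' t sg; exact: is_deriveB.
  have cd : {within `[0, s], continuous d}.
    by apply: derivable_within_continuous => t _; have [] := dd t.
  have [t] := MVT_segment (ltW s0) (fun t _ => dd t) cd.
  rewrite in_itv/= => ts dE.
  have [t' t's gE] := mvt_line (x + t *: v') w' (smooth_derive v' sg) s0.
  exists t, t'; split => //; move: dE; rewrite /d /d' subr0 !scale0r !addr0 => ->.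
  by rewrite (addrAC x (s *: w')) gE -addrA mulrC.
have near_x (k : 'rV[R]_N -> R) (e : R) : smooth k -> 0 < e -> exists2 r : R, 0 < r &
    forall s t t', 0 < s < r -> 0 <= t <= s -> 0 <= t' <= s ->
    `|k (x + (t *: v + t' *: w)) - k x| <= e.
  move=> sk e0; have /cvgrPdist_le/(_ _ e0) := @smooth_continuous k sk x.
  move=> /nbhs_normP[r /= r0 rP].
  have nvw : 0 < `|v| + `|w| + 1 by rewrite ltr_wpDl// addr_ge0.
  exists (r / (`|v| + `|w| + 1)); first by rewrite divr_gt0.
  move=> s t t' /andP[s0 sr] /andP[t0 ts] /andP[t'0 t's].
  rewrite distrC; apply: rP => /=.
  rewrite opprD addrA subrr sub0r normrN (le_lt_trans (ler_normD _ _))//.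
  rewrite !normrZ (ger0_norm t0) (ger0_norm t'0).
  apply: (@le_lt_trans _ _ (s * (`|v| + `|w| + 1))); last by rewrite -ltr_pdivlMr.
  rewrite !mulrDr mulr1; apply: ler_wpDr; first exact: ltW.
  by rewrite lerD// ler_wpM2r.
apply/eqP; rewrite -subr_eq0 -normr_le0; apply/ler_addgt0Pl => e e0; rewrite addr0.
have e20 : 0 < e / 2 by rewrite divr_gt0.
have [r1 r10 h1] := near_x _ _ (smooth_derive v sw) e20.
have [r2 r20 h2] := near_x _ _ (smooth_derive w sv) e20.
pose s := Num.min r1 r2 / 2.
have [s0 sr1 sr2] : [/\ 0 < s, s < r1 & s < r2].
  by rewrite /s; case: (leP r1 r2) => h; split; lra.
have [t [t' [ts t's E1]]] := second_difference v w s s0.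
have [t2 [t2' [t2s t2's E2]]] := second_difference w v s s0.
have E : 'D_w ('D_v g) (x + (t *: v + t' *: w)) = 'D_v ('D_w g) (x + (t2' *: v + t2 *: w)).
  apply: (mulfI (lt0r_neq0 s0)); apply: (mulfI (lt0r_neq0 s0)).
  rewrite (addrC (t2 *: w)) in E2.
  apply: etrans (esym E1) _; apply: etrans _ E2; rewrite (addrAC x (s *: v)).
  move: (g (x + s *: w + s *: v)) (g (x + s *: v)) (g (x + s *: w)) (g x) => a b c d.
  by ring.
have {}h1 := h1 s t2' t2 ltac:(by rewrite s0) t2's t2s.
have {}h2 := h2 s t t' ltac:(by rewrite s0) ts t's.
rewrite E in h2.
have dist3 (a b k : R) : `|k - a| <= e / 2 -> `|k - b| <= e / 2 -> `|a - b| <= e.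
  rewrite distrC => ka kb; rewrite -(subrKA k) [leRHS]splitr.
  exact: le_trans (ler_normD _ _) (lerD ka kb).
exact: dist3 h1 h2.
Qed.

End SmoothEuclidean.

Lemma second_derivative_at_max {R : realType} (p p1 : R -> R) (d : R) :
  (forall s : R, is_derive s (1 : R) p (p1 s)) -> is_derive (0 : R) (1 : R) p1 d ->
  (forall s, p s <= p 0) -> d <= 0.
Proof.
move=> dp dp1 pmax.
have p10 : p1 0 = 0.
  have der t : t \in `](-1 : R), 1[ -> derivable p t 1 by have [] := dp t.
  have z01 : (0 : R) \in `](-1 : R), 1[ by rewrite in_itv/= ltrN10 ltr01.
  have m11 : -1 <= 1 :> R := ltW (lt_trans (ltrN10 R) ltr01).
  have [_ E0] := @derive1_at_max R p (-1) 1 0 m11 der z01 (fun t _ => pmax t).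
  by have [_ E1] := dp 0; rewrite -E1 E0.
rewrite leNgt; apply/negP => d0.
have d20 : 0 < d / 2 by rewrite divr_gt0.
have [/derivable1_diffP dp1' E1] := dp1.
have /nbhs_norm0P[r /= r0 rP] := differentiable_eps dp1' d20.
have r20 : 0 < r / 2 by rewrite divr_gt0.
have cp : {within `[0, r / 2], continuous p}.
  by apply: derivable_within_continuous => t _; have [] := dp t.
have [c] := MVT r20 (fun t _ => dp t) cp.
rewrite in_itv/= subr0 => /andP[c0 cr] cE.
have := pmax (r / 2); rewrite -subr_le0 cE pmulr_lle0// => p1c.
have := rP c; rewrite /= gtr0_norm// => /(_ ltac:(lra)).
rewrite addr0 p10 subr0.
have -> : 'd p1 0 c = c * d.
  by rewrite -[X in 'd _ _ X]mulr1 linearZ /= -deriveE// E1.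
have := ler_norm (- (p1 c - c * d)); rewrite normrN => h1 h2.
have cd0 : 0 < c * d by rewrite mulr_gt0.
by have := le_trans h1 h2; lra.
Qed.

Section Bernstein.
Context {R : realType} {N : nat}.
Implicit Types (a b : 'rV[R]_N -> R) (v w x : 'rV[R]_N).

Lemma square_line a v x : smooth a ->
  let p1 (s : R) := 2 * a (x + s *: v) * 'D_v a (x + s *: v) in
  (forall s : R, is_derive s (1 : R) (fun s => a (x + s *: v) ^+ 2) (p1 s)) /\
  is_derive (0 : R) (1 : R) p1 (2 * ('D_v a x ^+ 2 + a x * 'D_v ('D_v a) x)).
Proof.
move=> sa p1; have d1 (s : R) := is_derive_line x v s sa.
have d2 (s : R) := is_derive_line x v s (smooth_derive v sa).
split=> [s|].
  apply: (is_derive_eq (@is_deriveX _ _ _ 2 _ _ _ (d1 s))).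
  by rewrite /p1 /GRing.scale /= expr1; ring.
have d3 := @is_deriveM _ _ _ _ _ _ _ _ (d1 0) (d2 0).
have d4 := @is_deriveZ _ _ _ _ 2 _ _ _ d3.
have E : (2 \*: ((fun s : R => a (x + s *: v)) * (fun s : R => 'D_v a (x + s *: v)))) = p1.
  by apply/funext => s; rewrite /p1 /= /GRing.scale /= mulrA.
rewrite E scale0r addr0 in d4; apply: (is_derive_eq d4).
by rewrite /GRing.scale /=; ring.
Qed.

(** These are the Cauchy-Riemann equations of a + ib along x + sv + tw. *)
Definition conjugate_pair a b v w :=
  forall x, 'D_v a x = 'D_w b x /\ 'D_w a x = - 'D_v b x.

Lemma conjugate_pair_derive a b v w : smooth a -> smooth b ->
  conjugate_pair a b v w -> conjugate_pair ('D_v a) ('D_v b) v w.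
Proof.
move=> sa sb ab x.
have E1 : 'D_v a = 'D_w b by apply/funext => y; have [] := ab y.
have E2 : 'D_w a = - 'D_v b by apply/funext => y; have [] := ab y.
rewrite {1}E1 (derive_comm v w x sb); split=> //.
rewrite -(derive_comm v w x sa) E2 deriveN//.
exact/diff_derivable/smooth_differentiable/smooth_derive.
Qed.

Lemma conjugate_pair_laplacian a b v w x : smooth a -> smooth b ->
  conjugate_pair a b v w ->
  'D_v ('D_v a) x + 'D_w ('D_w a) x = 0 /\ 'D_v ('D_v b) x + 'D_w ('D_w b) x = 0.
Proof.
move=> sa sb ab.
have E1 : 'D_v a = 'D_w b by apply/funext => y; have [] := ab y.
have E2 : 'D_w a = - 'D_v b by apply/funext => y; have [] := ab y.
have dvb y u : derivable ('D_v b) y u.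
  exact/diff_derivable/smooth_differentiable/smooth_derive.
have dwa y u : derivable ('D_w a) y u.
  exact/diff_derivable/smooth_differentiable/smooth_derive.
split; first by rewrite E1 E2 deriveN// (derive_comm v w x sb) subrr.
rewrite -E1; have -> : 'D_v b = - 'D_w a by rewrite E2 opprK.
by rewrite deriveN// (derive_comm v w x sa) addNr.
Qed.

Let gradient_bound (lam A B va vb wa wb vva wwa vvb wwb wva wvb vvva wwva vvvb wwvb : R) :
  0 < lam -> vva + wwa = 0 -> vvb + wwb = 0 -> vvva + wwva = 0 -> vvvb + wwvb = 0 ->
  (vva ^+ 2 + va * vvva) + (vvb ^+ 2 + vb * vvvb)
    + lam * ((va ^+ 2 + A * vva) + (vb ^+ 2 + B * vvb)) <= 0 ->
  (wva ^+ 2 + va * wwva) + (wvb ^+ 2 + vb * wwvb)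
    + lam * ((wa ^+ 2 + A * wwa) + (wb ^+ 2 + B * wwb)) <= 0 ->
  lam * (va ^+ 2 + vb ^+ 2) <= 0.
Proof.
move=> lam0 /eqP; rewrite addr_eq0 => /eqP -> /eqP; rewrite addr_eq0 => /eqP ->.
move=> /eqP; rewrite addr_eq0 => /eqP -> /eqP; rewrite addr_eq0 => /eqP -> hv hw.
have := lerD hv hw; rewrite addr0 => h; apply: le_trans h; rewrite -subr_ge0.
have : 0 <= wwa ^+ 2 + wva ^+ 2 + wwb ^+ 2 + wvb ^+ 2 + lam * (wa ^+ 2 + wb ^+ 2).
  apply: addr_ge0; first by rewrite !addr_ge0 ?sqr_ge0.
  by apply: mulr_ge0; [exact: ltW|rewrite addr_ge0 ?sqr_ge0].
by move=> /le_trans; apply; rewrite le_eqVlt; apply/orP; left; apply/eqP; ring.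
Qed.

(** The functions a, b, 'D_v a and 'D_v b are harmonic in the plane of v and w, so
    the Laplacian of the sum of squares reduces to squared first derivatives, and
    the second derivatives at a maximum are not positive. *)
Lemma derive_eq0_at_max a b v w (lam : R) x0 : smooth a -> smooth b ->
  conjugate_pair a b v w -> 0 < lam ->
  (forall x, 'D_v a x ^+ 2 + 'D_v b x ^+ 2 + lam * (a x ^+ 2 + b x ^+ 2) <=
     'D_v a x0 ^+ 2 + 'D_v b x0 ^+ 2 + lam * (a x0 ^+ 2 + b x0 ^+ 2)) ->
  'D_v a x0 = 0 /\ 'D_v b x0 = 0.
Proof.
move=> sa sb ab lam0 xmax.
have sva := smooth_derive v sa; have svb := smooth_derive v sb.
have abv := conjugate_pair_derive sa sb ab.
have second u : ('D_u ('D_v a) x0 ^+ 2 + 'D_v a x0 * 'D_u ('D_u ('D_v a)) x0)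
    + ('D_u ('D_v b) x0 ^+ 2 + 'D_v b x0 * 'D_u ('D_u ('D_v b)) x0)
    + lam * (('D_u a x0 ^+ 2 + a x0 * 'D_u ('D_u a) x0)
             + ('D_u b x0 ^+ 2 + b x0 * 'D_u ('D_u b) x0)) <= 0.
  have half (s1 s2 s3 s4 : R) : 2 * s1 + 2 * s2 + lam * (2 * s3 + 2 * s4) <= 0 ->
      s1 + s2 + lam * (s3 + s4) <= 0.
    by move=> h; rewrite -(ler_pM2l (ltr0n R 2)) mulr0 (le_trans _ h)// !mulrDr !(mulrCA 2).
  have [p1 p1'] := square_line u x0 sva; have [p2 p2'] := square_line u x0 svb.
  have [p3 p3'] := square_line u x0 sa; have [p4 p4'] := square_line u x0 sb.
  have comb f1 f2 f3 f4 (e1 e2 e3 e4 : R) (s : R) : is_derive s (1 : R) f1 e1 ->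
      is_derive s (1 : R) f2 e2 -> is_derive s (1 : R) f3 e3 -> is_derive s (1 : R) f4 e4 ->
      is_derive s (1 : R) (fun t => f1 t + f2 t + lam * (f3 t + f4 t) : R)
        (e1 + e2 + lam * (e3 + e4)).
    move=> h1 h2 h3 h4; have h12 := is_deriveD h1 h2; have h34 := is_deriveD h3 h4.
    exact: (is_deriveD h12 (@is_deriveZ _ _ _ _ lam _ _ _ h34)).
  have := @second_derivative_at_max R _ _ _
    (fun s => comb _ _ _ _ _ _ _ _ s (p1 s) (p2 s) (p3 s) (p4 s))
    (comb _ _ _ _ _ _ _ _ 0 p1' p2' p3' p4').
  rewrite scale0r addr0 => /(_ (fun s => xmax _)) h.
  exact: half h.
have [La Lb] := conjugate_pair_laplacian x0 sa sb ab.
have [Lva Lvb] := conjugate_pair_laplacian x0 sva svb abv.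
have hv := second v; have hw := second w.
have sq_ge (t : R) : 0 <= t ^+ 2 by exact: sqr_ge0.
have : lam * ('D_v a x0 ^+ 2 + 'D_v b x0 ^+ 2) <= 0.
  exact: gradient_bound lam0 La Lb Lva Lvb hv hw.
rewrite pmulr_rle0// => h.
have va0 : 'D_v a x0 ^+ 2 = 0.
  by apply/eqP; rewrite eq_le sq_ge andbT (le_trans _ h)// lerDl.
have vb0 : 'D_v b x0 ^+ 2 = 0.
  by apply/eqP; rewrite eq_le sq_ge andbT (le_trans _ h)// lerDr.
by split; apply/eqP; rewrite -sqrf_eq0; apply/eqP.
Qed.

End Bernstein.

(** * Global solutions are constant *)

Section TorusTopology.
Context {R : realType} {N : nat} (T : torus R N).

(** The image is an open subgroup, and the complement of an open subgroup is
    open. *)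
Lemma torus_exp_surj (t : T) : exists v, torus_exp T v = t.
Proof.
pose H := range (torus_exp T).
have oH : open H by apply: torus_exp_open; exact: openT.
have H0 : H 0 by exists 0 => //; rewrite raddf0.
have HB y z : H y -> H z -> H (y - z).
  by move=> [v _ <-] [w _ <-]; exists (v - w) => //; rewrite raddfB.
have cH : closed H.
  rewrite -[H]setCK; apply: open_closedC; rewrite openE => y /= yH.
  have yy0 : (fun z : T => z - y) @ y --> (0 : T).
    have pc : (fun z : T => (z, y)) @ y --> (y, y) by apply: cvg_pair => //; exact: cvg_cst.
    have := @cvg_comp _ _ _ (fun z : T => (z, y)) (fun p : T * T => p.1 - p.2)
      (nbhs y) (nbhs (y, y)) _ pc (@sub_continuous T (y, y)).
    by rewrite /= subrr.
  have : \forall z \near y, H (z - y) by apply: yy0; exact: open_nbhs_nbhs.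
  apply: filterS => z /= Hzy Hz; apply: yH.
  by have := HB _ _ Hz Hzy; rewrite opprB addrCA subrr addr0.
have HT : H = setT.
  apply: (@torus_connected R N T); first by exists 0.
    by exists H => //; rewrite setTI.
  by exists H => //; rewrite setTI.
have : H t by rewrite HT.
by move=> [v _ <-]; exists v.
Qed.

(** The exponential is open and onto, so psi inherits continuity from the
    composite. *)
Lemma max_on_torus (psi : T -> R) : continuous (psi \o torus_exp T) ->
  exists v, forall w, psi (torus_exp T w) <= psi (torus_exp T v).
Proof.
move=> cpsi.
have cT : continuous psi.
  apply/continuousP => O oO.
  have -> : psi @^-1` O = torus_exp T @` ((psi \o torus_exp T) @^-1` O).
    apply/seteqP; split=> [t Ot|_ [v Ov <-]//].
    have [v vt] := torus_exp_surj t; exists v => //=.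
    by rewrite /preimage /= vt.
  by apply: torus_exp_open; apply: open_comp => // v _; exact: cpsi.
have [t _ tmax] := @compact_EVT_max T R psi setT (ex_intro _ 0 I) (@torus_compact _ _ T)
  (continuous_subspaceT cT).
have [v vt] := torus_exp_surj t; exists v => w.
by rewrite vt; apply: tmax; rewrite inE.
Qed.

End TorusTopology.

Section GlobalSolutions.
Context {R : realType} {N : nat} (T : torus R N).
Local Notation C := R[i].
Variable f : T -> C.
Hypothesis smooth_f : forall x, smooth_near f x.

Let a := @complex.Re R \o in_chart f 0.
Let b := @complex.Im R \o in_chart f 0.

Let aE v : a v = complex.Re (f (torus_exp T v)).
Proof. by rewrite /a /in_chart /= add0r. Qed.

Let bE v : b v = complex.Im (f (torus_exp T v)).
Proof. by rewrite /b /in_chart /= add0r. Qed.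

Lemma smooth_chart : smooth a /\ smooth b.
Proof.
suff H n : Ck n setT a /\ Ck n setT b by split=> n; have [] := H n.
have loc (v : 'rV[R]_N) : exists2 U, open_nbhs v U & Ck n U a /\ Ck n U b.
  have [U [oU U0] fU] := smooth_f (torus_exp T v).
  exists [set x | U (x - v)].
    split; last by rewrite /= subrr.
    apply: (@open_comp _ _ (fun x : 'rV[R]_N => x - v) U _ oU) => x _.
    exact/differentiable_continuous/differentiableB.
  have [fr fi] := fU n.
  have E y : in_chart f (torus_exp T v) y = in_chart f 0 (v + y).
    by rewrite -[torus_exp T v]add0r in_chartD.
  by split; apply: Ck_translate; [apply: Ck_eq oU _ fr|apply: Ck_eq oU _ fi] => y _ /=;
    rewrite E.
by split; apply: Ck_local => v; have [U vU [Ua Ub]] := loc v; exists U.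
Qed.

Let vfieldR_exp v w : vfieldR w f (torus_exp T v) = 'D_w a v +i* 'D_w b v.
Proof. by rewrite -[torus_exp T v]add0r vfieldR_chart. Qed.

Variables v w : 'rV[R]_N.
Hypothesis sol : forall x, vfieldR v f x + (0 +i* 1) * vfieldR w f x = 0.

Let cr : conjugate_pair a b v w.
Proof.
have cr_eq (p q r s : R) : (p +i* q) + (0 +i* 1) * (r +i* s) = 0 -> p = s /\ r = - q.
  by move=> /= [h1 h2]; split; lra.
by move=> x; apply: cr_eq; rewrite -!vfieldR_exp.
Qed.

(** Comparing the value of |D_v f|^2 + lam |f|^2 at x and at its maximum gives
    |D_v f x|^2 <= lam max |f|^2; then lam tends to 0. *)
Lemma derive_solution_eq0 x :
  [/\ 'D_v a x = 0, 'D_v b x = 0, 'D_w a x = 0 & 'D_w b x = 0].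
Proof.
have [sa sb] := smooth_chart.
have sva := smooth_derive v sa; have svb := smooth_derive v sb.
have sq_cont (g : 'rV[R]_N -> R) : smooth g -> continuous (fun x => g x ^+ 2).
  move=> sg y; have gc := @smooth_continuous _ _ g sg y.
  exact: (continuousM gc gc).
have sum_cont (g1 g2 : 'rV[R]_N -> R) : smooth g1 -> smooth g2 ->
    continuous (fun x => g1 x ^+ 2 + g2 x ^+ 2).
  by move=> s1 s2 y; exact: (cvgD (@sq_cont _ s1 y) (@sq_cont _ s2 y)).
have [x1 x1max] : exists x1, forall x, a x ^+ 2 + b x ^+ 2 <= a x1 ^+ 2 + b x1 ^+ 2.
  have := @max_on_torus _ _ T (fun t => complex.Re (f t) ^+ 2 + complex.Im (f t) ^+ 2).
  rewrite (_ : _ \o torus_exp T = fun x => a x ^+ 2 + b x ^+ 2); last first.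
    by apply/funext => y; rewrite aE bE.
  move=> /(_ (sum_cont _ _ sa sb))[x1 x1max]; exists x1 => y.
  by rewrite !aE !bE.
set M := a x1 ^+ 2 + b x1 ^+ 2 in x1max.
have M0 : 0 <= M by rewrite addr_ge0 ?sqr_ge0.
have bound lam : 0 < lam -> 'D_v a x ^+ 2 + 'D_v b x ^+ 2 <= lam * M.
  move=> lam0.
  pose psi t := complex.Re (vfieldR v f t) ^+ 2 + complex.Im (vfieldR v f t) ^+ 2
    + lam * (complex.Re (f t) ^+ 2 + complex.Im (f t) ^+ 2).
  have psiE y : psi (torus_exp T y) =
      'D_v a y ^+ 2 + 'D_v b y ^+ 2 + lam * (a y ^+ 2 + b y ^+ 2).
    by rewrite /psi vfieldR_exp aE bE.
  have [] := @max_on_torus _ _ T psi.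
    rewrite (_ : _ \o _ = fun y => ('D_v a y ^+ 2 + 'D_v b y ^+ 2) + lam * (a y ^+ 2 + b y ^+ 2)).
      move=> y; have cst_lam : {for y, continuous (fun _ : 'rV[R]_N => lam)}.
        exact: cst_continuous.
      have c1 := @sum_cont _ _ sva svb y; have c2 := @sum_cont _ _ sa sb y.
      exact: (cvgD c1 (cvgM cst_lam c2)).
    by apply/funext => y /=; rewrite psiE.
  move=> x0 x0max.
  have {}x0max y : 'D_v a y ^+ 2 + 'D_v b y ^+ 2 + lam * (a y ^+ 2 + b y ^+ 2) <=
      'D_v a x0 ^+ 2 + 'D_v b x0 ^+ 2 + lam * (a x0 ^+ 2 + b x0 ^+ 2).
    by rewrite -!psiE.
  have [a0 b0] := derive_eq0_at_max sa sb cr lam0 x0max.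
  have := x0max x; rewrite a0 b0 expr0n addr0 add0r => h.
  have hM : lam * (a x0 ^+ 2 + b x0 ^+ 2) <= lam * M by rewrite ler_pM2l.
  apply: le_trans (le_trans h hM); rewrite lerDl mulr_ge0 ?addr_ge0 ?sqr_ge0//.
  exact: ltW.
have h0 : 'D_v a x ^+ 2 + 'D_v b x ^+ 2 <= 0.
  apply/ler_addgt0Pl => e e0; rewrite addr0.
  have M1 : 0 < M + 1 by rewrite ltr_wpDl.
  apply: le_trans (bound (e / (M + 1)) (divr_gt0 e0 M1)) _.
  by rewrite mulrAC ler_pdivrMr// ler_pM2l// lerDl.
have sq0 (s t : R) : s ^+ 2 + t ^+ 2 <= 0 -> s = 0 /\ t = 0.
  move=> st; have : s ^+ 2 + t ^+ 2 == 0 by rewrite eq_le st addr_ge0 ?sqr_ge0.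
  by rewrite paddr_eq0 ?sqr_ge0// !sqrf_eq0 => /andP[/eqP -> /eqP ->].
have [va vb] := sq0 _ _ h0; have [E1 E2] := cr x.
by split; rewrite // -?E1 ?E2 ?vb ?oppr0.
Qed.

End GlobalSolutions.

(** The differential of the real part of f at a point is a real covector that
    annihilates h, hence zero; likewise for the imaginary part. *)
Lemma global_solution_constant {R : realType} {N : nat} (T : torus R N)
    (h : {vspace 'rV[R[i]]_N}) (f : T -> R[i]) : hypocomplex T h ->
  (forall x, smooth_near f x) ->
  (forall x Z, Z \in h -> vfield Z f x = 0) -> forall x y, f x = f y.
Proof.
move=> hypo sf sol.
suff const g : (g = @complex.Re R \o in_chart f 0 \/ g = @complex.Im R \o in_chart f 0) ->
    forall v, g v = g 0.
  move=> x y; have [v <-] := torus_exp_surj x; have [w <-] := torus_exp_surj y.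
  have E u : f (torus_exp T u) = in_chart f 0 u by rewrite /in_chart add0r.
  have cr := const _ (or_introl erefl); have ci := const _ (or_intror erefl).
  rewrite !E; move: (cr v) (cr w) (ci v) (ci w) => /=.
  by case: (in_chart f 0 v) => ? ?; case: (in_chart f 0 w) => ? ? /= -> -> -> ->.
move=> gE.
have [sa sb] := smooth_chart sf.
have sg : smooth g by case: gE => ->.
have dg0 Z x : Z \in h -> 'D_(map_mx (@complex.Re R) Z) g x = 0 /\
    'D_(map_mx (@complex.Im R) Z) g x = 0.
  move=> Zh; have [] := @derive_solution_eq0 _ _ T f sf _ _ (fun x => sol x Z Zh) x.
  by case: gE => ->.
have dg x u : 'D_u g x = 0.
  pose xi := \row_k 'D_(delta_mx 0 k) g x.
  have dgE u' : 'D_u' g x = lin xi u'.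
    have dgx := smooth_differentiable x sg.
    rewrite deriveE// linE [in LHS](row_sum_delta u') linear_sum.
    by apply: eq_bigr => k _; rewrite linearZ mxE deriveE.
  have -> := dgE u; suff -> : xi = 0 by rewrite linE big1// => k _; rewrite mxE mulr0.
  apply: (hypocomplex_no_real_annihilator hypo) => Z Zh.
  by have [] := dg0 Z x Zh; rewrite !dgE.
move=> v; apply/eqP; rewrite -subr_eq0 -normr_le0.
have := @increment_bound R (fun s => g (0 + s *: v)) (fun s => 'D_v g (0 + s *: v)) 0 1 0 ler01
  (fun s _ => is_derive_line 0 v s sg).
rewrite mul0r scale0r scale1r !add0r; apply => s _.
by rewrite dg normr0.
Qed.

(** * Classes of forms *)

Section RowsIn.
Context {K : fieldType} {N : nat}.

Definition rows_in (h : {vspace 'rV[K]_N}) (k : nat) (X : 'M[K]_(k, N)) : nat :=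
  #|[pred i : 'I_k | row i X \in h]|.

Lemma rows_inE (h : {vspace _}) k (X : 'M[K]_(k, N)) :
  rows_in h X = (\sum_(i < k) (row i X \in h))%N.
Proof. by rewrite /rows_in -sum1_card big_mkcond. Qed.

Lemma row0_col_mx k (Z : 'rV[K]_N) (X : 'M[K]_(k, N)) :
  row (ord0 : 'I_(1 + k)) (col_mx Z X) = Z.
Proof.
have -> : (ord0 : 'I_(1 + k)) = lshift k 0 by apply: val_inj.
by rewrite rowKu row_id.
Qed.

Lemma rowS_col_mx k (Z : 'rV[K]_N) (X : 'M[K]_(k, N)) i :
  row (lift (ord0 : 'I_(1 + k)) i) (col_mx Z X) = row i X.
Proof.
have -> : lift (ord0 : 'I_(1 + k)) i = rshift 1 i by apply: val_inj.
by rewrite rowKd.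
Qed.

Lemma row'0_col_mx k (Z : 'rV[K]_N) (X : 'M[K]_(k, N)) :
  row' (ord0 : 'I_(1 + k)) (col_mx Z X) = X.
Proof. by apply/row_matrixP => i; rewrite row_rowsub rowS_col_mx. Qed.

Lemma row'S_col_mx k (Z : 'rV[K]_N) (X : 'M[K]_(k.+1, N)) (i : 'I_k.+1) :
  row' (lift (ord0 : 'I_k.+2) i) (col_mx Z X) = col_mx Z (row' i X).
Proof.
apply/row_matrixP => j; rewrite row_rowsub.
case: (unliftP (ord0 : 'I_(1 + k)) j) => [l|] ->.
  rewrite rowS_col_mx row_rowsub -(rowS_col_mx Z X).
  by congr (row _ _); apply: val_inj; rewrite /= /bump !leq0n !add1n ltnS addnS.
rewrite row0_col_mx -[RHS](row0_col_mx Z X).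
by congr (row _ _); apply: val_inj.
Qed.

Lemma rows_in_col_mx (h : {vspace _}) k (Z : 'rV[K]_N) (X : 'M[K]_(k, N)) :
  Z \in h -> rows_in h (col_mx Z X) = (rows_in h X).+1.
Proof.
move=> Zh; rewrite !rows_inE big_split_ord /= big_ord1 rowKu row_id Zh.
rewrite -[RHS]add1n; congr (_ + _)%N; apply: eq_bigr => i _; by rewrite rowKd.
Qed.

Lemma rows_in_row' (h : {vspace _}) k (X : 'M[K]_(k.+1, N)) i :
  (rows_in h X <= (rows_in h (row' i X)).+1)%N.
Proof.
rewrite !rows_inE (bigD1_ord i)//=.
under [X in (_ <= X.+1)%N]eq_bigr do rewrite row_rowsub.
by case: (row i X \in h); rewrite ?add0n ?leqnSn.
Qed.

Lemma rows_in_row'S_col_mx (h : {vspace _}) k (Z : 'rV[K]_N) (X : 'M[K]_(k, N)) i :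
  Z \in h -> (0 < rows_in h (row' (lift (ord0 : 'I_(1 + k)) i) (col_mx Z X)))%N.
Proof.
case: k X i => [X []//|k X i] Zh.
by rewrite row'S_col_mx (rows_in_col_mx (row' i X) Zh).
Qed.

End RowsIn.

Section Classes.
Context {R : realType} {N : nat} (T : torus R N) (h : {vspace 'rV[R[i]]_N}).

Lemma zero_in_N p q k : in_N h p q (fun (_ : T) (_ : 'M[R[i]]_(k, N)) => 0).
Proof.
case: q => [q|q] //=; split => //; split.
- by move=> x X Y W i b c _ _ _; rewrite !mulr0 addr0.
- by [].
- by move=> X x; exact: smooth_near_cst.
Qed.

Lemma mem_coset p q (u : dform T (q + p)) :
  in_N h p q%:Z u -> coset T h p q u u.
Proof.
move=> uN; split=> //.
rewrite (_ : (fun x X => _) = fun _ _ => 0); first exact: zero_in_N.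
by apply/funext => x; apply/funext => X; rewrite subrr.
Qed.

Lemma in_N_pred_eq0 p q k (w : dform T k) x X : in_N h p.+1 (q%:Z - 1) w ->
  (q <= rows_in h X)%N -> w x X = 0.
Proof.
case: q => [|q] /=; first by move=> ->.
rewrite subn1 /= => -[_ w0] qX; exact: w0.
Qed.

Lemma coset_eq p q (u v : dform T (q + p)) x X : coset T h p q u v ->
  (q <= rows_in h X)%N -> v x X = u x X.
Proof.
by move=> [_ /in_N_pred_eq0 H] qX; apply/eqP; rewrite -subr_eq0; apply/eqP/H.
Qed.

(** The zero form belongs to the class L'_Z u, which provides representatives of
    d u and i_Z u.  They agree with d u and i_Z u on the arguments concerned, and in
    i_Z (d u) + d (i_Z u) all terms but Z (u X) cancel.  For q = 0 the second
    summand is absent, but then the other terms of i_Z (d u) contain u at arguments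
    with an entry in h. *)
Lemma Lie'_zero_vfield p q (u : dform T (q + p)) Z X x :
  in_N h p q%:Z u -> Z \in h ->
  Lie' T h Z p q (coset T h p q u) = zero_class T h p q ->
  (q <= rows_in h X)%N ->
  vfield Z (fun y => u y X) x = 0.
Proof.
move=> uN Zh E qX.
have : Lie' T h Z p q (coset T h p q u) (fun _ _ => 0).
  by rewrite E; apply: mem_coset; exact: zero_in_N.
have ZX : (q < rows_in h (col_mx Z X))%N by rewrite rows_in_col_mx.
move: u X uN {E} qX ZX; case: q => [|q] u X uN qX ZX /=.
  move=> [w1 [u1 u1u w1u1]] aw1; have /esym := coset_eq x aw1 qX.
  rewrite /interior_prod (coset_eq x w1u1 ZX) /ext_d => <-; apply: esym.
  rewrite big_ord_recl big1 ?addr0 ?expr0 ?mul1r; last first.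
    move=> i _; rewrite (_ : (fun y => _) = fun _ => 0) ?vfield_cst ?mulr0//.
    apply/funext => y; have [[_ u10] _] := u1u; apply: u10.
      by case: (p) i => [[]|].
    exact: rows_in_row'S_col_mx.
  rewrite row0_col_mx row'0_col_mx; congr (vfield _ _ _); apply/funext => y.
  by rewrite (coset_eq _ u1u qX).
move=> [a [b [[w1 [u1 u1u w1u1] aw1] [w2 [u2 u2u w2u2] bw2]]]].
move=> /(congr1 (fun w => w x X)).
rewrite (coset_eq x aw1 qX) (coset_eq x bw2 qX) /interior_prod (coset_eq x w1u1 ZX).
rewrite /ext_d big_ord_recl expr0 mul1r row0_col_mx row'0_col_mx.
rewrite (_ : (fun y => u1 y X) = fun y => u y X); last first.
  by apply/funext => y; rewrite (coset_eq _ u1u qX).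
rewrite -addrA -big_split big1 ?addr0 //= => i _.
rewrite rowS_col_mx row'S_col_mx.
have qi : (q <= rows_in h (row' i X))%N.
  by rewrite -ltnS (leq_trans qX) // rows_in_row'.
have qZ : (q < rows_in h (col_mx Z (row' i X)))%N by rewrite rows_in_col_mx.
rewrite (_ : (fun y => u1 y _) = fun y => w2 y (row' i X)); last first.
  apply/funext => y; rewrite (coset_eq _ w2u2 qi) /interior_prod.
  by rewrite (coset_eq _ u1u qZ) (coset_eq _ u2u qZ).
by rewrite /bump /= add1n exprS mulN1r mulNr addNr.
Qed.

Lemma in_N_predB p q (v w : dform T (q + p)) :
  in_N h p q%:Z v -> in_N h p q%:Z w ->
  (forall x X, (q <= rows_in h X)%N -> v x X = w x X) ->
  in_N h p.+1 (q%:Z - 1) (fun x X => v x X - w x X).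
Proof.
case: q v w => [|q] v w [[v1 v2 v3] v4] [[w1 w2 w3] w4] vw /=.
  by move=> x X; rewrite vw// subrr.
rewrite subn1/=; split; last by move=> _ x X qX; rewrite vw// subrr.
split.
- move=> x X Y W i b c XYW Y' W'.
  by rewrite (v1 x X Y W i b c)// (w1 x X Y W i b c)//; ring.
- by move=> x X i j ij XY; rewrite (v2 x X i j)// (w2 x X i j)// subrr.
- by move=> X x; apply: smooth_nearB.
Qed.

(** The invariant representative is u frozen at the origin: it agrees with u on
    all arguments with at least q entries in h. *)
Lemma left_invariant_of_constant_solutions p q (U : set (dform T (q + p))) :
  (forall f : T -> R[i], (forall x, smooth_near f x) ->
     (forall x Z, Z \in h -> vfield Z f x = 0) -> forall x y, f x = f y) ->
  Lambda T h p q U ->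
  (forall Z, Z \in h -> Lie' T h Z p q U = zero_class T h p q) ->
  left_invariant_class T h p q U.
Proof.
move=> cst_sol [u uN ->] LU; have [[umul ualt usm] u0] := uN.
have u_cst (X : 'M[R[i]]_(q + p, N)) x : (q <= rows_in h X)%N -> u x X = u 0 X.
  move=> qX; apply: (cst_sol (fun y => u y X)) => // y Z Zh.
  exact: Lie'_zero_vfield (LU Z Zh) qX.
have sm_cst (X : 'M[R[i]]_(q + p, N)) x : smooth_near (fun _ : T => u 0 X) x.
  exact: smooth_near_cst.
have vN : in_N h p q%:Z (fun (_ : T) X => u 0 X).
  by split; [split => // x|move=> p0 x X qX; exact: u0].
exists (fun _ X => u 0 X); split => //.
apply/seteqP; split=> w [wN wu]; split => //; apply: in_N_predB => // x X qX.
  by rewrite -(u_cst X x qX); apply: coset_eq qX.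
by rewrite (u_cst X x qX); rewrite (@coset_eq p q (fun _ X => u 0 X) w).
Qed.
End Classes.

Theorem proposition3p3p12 (R : realType) (N : nat) (T : torus R N)
    (h : {vspace 'rV[R[i]]_N}) (hypo : hypocomplex T h)
    (p q : nat) (u : set (dform T (q + p))) (u_Lambda : u \in Lambda T h p q) :
  (forall Z : 'rV[R[i]]_N, Z \in h -> Lie' T h Z p q u = zero_class T h p q) ->
  left_invariant_class T h p q u.
Proof.
apply: left_invariant_of_constant_solutions (set_mem u_Lambda) => f.
exact: global_solution_constant.
Qed.
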